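(* Let $S\ge s>t>0$, $B>0$ and $\alpha>0$. For $n>0$ let $j=\lfloor \frac{1}{2t+1/2}\frac{\log n}{\log 2}\rfloor$, with $n$ such that $j\ge J_0$. Let $$\rho_n=\tilde C(\alpha)\,n^{-t/(2t+1/2)},\qquad \tilde C(\alpha)=24\Big(\frac{2^tB}{\sqrt{1-2^{-2t}}}+19\Big)\sqrt{\frac{z_0}{\alpha}} .$$ Consider the testing problem $$H_0: f\in\Sigma(s,B)\quad\text{vs.}\quad H_1: f\in\tilde\Sigma(t,B,\rho_n),$$ and the test $$\Psi_n(\alpha)=1-\prod_{J_0\le l\le j}\mathbf 1\{T_n(l)<t_n(l)^2\},$$ where $T_n(l)=\|\Pi_{W_l}\hat f_n\|_2^2-\frac{2^l}{n}$ for $J_0<l\le j$, $T_n(J_0)=\|\Pi_{W_{J_0}}\hat f_n\|_2^2-\frac{z_0}{n}$, and for $J_0\le l\le j$ $$t_n(l)^2=\Big(\frac{B}{2^{ls}}+\frac{\tau_l}{2}\Big)^2,\qquad \tau_l=24\sqrt{\frac{z_0}{\alpha}}\,\frac{2^{(j+l)/8}}{\sqrt n}\ \ (J_0<l\le j),\qquad \tau_{J_0}=24\sqrt{\frac{z_0}{\alpha}}\,\frac{1}{\sqrt n}.$$ Then $\Psi_n(\alpha)$ is $\alpha$-consistent, that is, for every such $n$, $$\sup_{f\in\Sigma(s,B)}\mathbb E_f\Psi_n(\alpha)+\sup_{f\in\tilde\Sigma(t,B,\rho_n)}\mathbb E_f\big(1-\Psi_n(\alpha)\big)\le\alpha .$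$
   Context: $L_2=L_2([0,1])$ with norm $\|\cdot\|_2$ and scalar product $\langle f,g\rangle=\int_0^1fg$. Wavelet basis: $\{\psi_{l,k}: l\ge J_0,\ k\in Z_l\}$ is the Cohen–Daubechies–Vial orthonormal wavelet basis of $L_2([0,1])$ with $S$ first null moments, where $J_0=J_0(S)\in\mathbb N^*$, the functions $\psi_{J_0,k}=\phi_k$ ($k\in Z_{J_0}$) are the scaling functions, $|Z_l|=2^l$ for $l\ge J_0+1$, and $z_0=|Z_{J_0}|$ satisfies $1\le z_0<\infty$. Besov balls: for $r>0$, $\|f\|_{r,2,\infty}=\sup_{l\ge J_0}2^{lr}\big(\sum_{k\in Z_l}\langle f,\psi_{l,k}\rangle^2\big)^{1/2}$, and for $B>0$, $\Sigma(r,B)=\{f\in L_2:\|f\|_{r,2,\infty}<B\}$. For $G\subset L_2$, $\|f-G\|_2=\inf_{g\in G}\|f-g\|_2$. For $\rho_n\ge0$, $\tilde\Sigma(t,B,\rho_n)=\{f\in\Sigma(t,B):\|f-\Sigma(s,B)\|_2\ge\rho_n\}$. Observations: for $n>0$ one observes $dY^{(n)}(x)=f(x)\,dx+\frac{dB_x}{\sqrt n}$, $x\in[0,1]$, with $(B_x)$ a standard Brownian motion and $f\in L_2$ unknown. The empirical coefficients are $\hat a_{l,k}=\int_0^1\psi_{l,k}\,dY^{(n)}$; under $f$ they are independent with $\hat a_{l,k}\sim\mathcal N(\langle\psi_{l,k},f\rangle,1/n)$. Formally $\hat f_n=\sum_{l\ge J_0}\sum_{k\in Z_l}\hat a_{l,k}\psi_{l,k}$,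 and $\Pi_{W_l}\hat f_n=\sum_{k\in Z_l}\hat a_{l,k}\psi_{l,k}$ is its projection onto $W_l=\mathrm{span}(\psi_{l,k},k\in Z_l)$, so $\|\Pi_{W_l}\hat f_n\|_2^2=\sum_{k\in Z_l}\hat a_{l,k}^2$. $\mathbb E_f$ denotes expectation when the data are generated by $f$. *)

(* Defs.v *)
From HB Require Import structures.
From mathcomp Require Import all_boot all_order all_algebra.
From mathcomp Require Import all_classical all_reals all_analysis.
Set Implicit Arguments.
Unset Strict Implicit.
Unset Printing Implicit Defensive.
Import Order.TTheory GRing.Theory Num.Theory.
Import numFieldNormedType.Exports.
Local Open Scope classical_set_scope.
Local Open Scope ring_scope.

Section L2.
Context {R : realType}.

Definition lebesgue01 : {measure set (measurableTypeR R) -> \bar R} :=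
  mrestr lebesgue_measure (measurable_itv `[0%R, 1%R]).

(* Elements of L_2([0,1]) are represented by functions R -> R; everything below
   depends only on their restriction to [0,1], up to null sets. *)
Definition L2 : set (R -> R) := [set f | f \in Lfun lebesgue01 2%:E].

Definition inner (f g : R -> R) : R := (\int[lebesgue01]_x (f x * g x))%R.

Definition norm2 (f : R -> R) : R := fine ('N[lebesgue01]_2%:E[EFin \o f])%E.

Definition dist2 (f : R -> R) (G : set (R -> R)) : R :=
  inf [set norm2 (f \- g) | g in G].

End L2.

Section wavelet_basis.
Context {R : realType}.

(* phi and psi are a Daubechies scaling function and mother wavelet with S null
   moments, both supported in [1 - S, S]; h n stands for the filter tap usually
   written h_{n-S+1}, and psi = sqrt 2 * sum_n (-1)^n h_{1-n} phi(2 . - n). *)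
Record daubechies (S : nat) (phi psi : R -> R) : Prop := {
  daub_L2 : phi \in Lfun lebesgue_measure 2%:E ;
  daub_supp : forall x : R, x \notin `[1 - S%:R, S%:R] -> phi x = 0 ;
  daub_mass : (\int[lebesgue_measure]_x phi x)%R = 1 ;
  daub_ortho : forall k : int,
    (\int[lebesgue_measure]_x (phi x * phi (x - k%:~R)))%R = (k == 0)%:R ;
  daub_refine : exists h : nat -> R,
    {ae (@lebesgue_measure R), forall x, phi x =
       Num.sqrt 2 * \sum_(n < 2 * S) h n * phi (2 * x - n%:R + S%:R - 1)} /\
    {ae (@lebesgue_measure R), forall x, psi x =
       Num.sqrt 2 * \sum_(n < 2 * S) (-1) ^+ (n + S.-1) * h (2 * S - n.+1)%N *
         phi (2 * x - n%:R + S%:R - 1)} ;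
  daub_moments : forall m, (m < S)%N ->
    (\int[lebesgue_measure]_x (x ^+ m * psi x))%R = 0 }.

(* |Z_l|; the index set Z_l is {0, ..., |Z_l| - 1}. *)
Definition card_Z (J0 z0 l : nat) : nat := if l == J0 then z0 else (2 ^ l)%N.

(* Cohen-Daubechies-Vial basis of L_2([0,1]) with S null moments.
   For l > J0 the wavelets are enumerated from left to right: S left edge
   wavelets, the 2^l - 2S dilated translates of the mother wavelet that live
   inside [0,1], and S right edge wavelets.  Up to dilation, the edge wavelets
   do not depend on l; they are restrictions to the half lines x >= 0 and x <= 1
   of finite combinations of the translates of phi at the next finer scale:
   phi(2 y - i) with 1 - S <= i <= 3S - 2 (left, y = 2^l x) and 1 - 3S <= i <=
   S - 2 (right, y = 2^l (x - 1)).  The psi J0 k are the scaling functions: by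
   orthonormality and completeness they span the orthogonal complement of the
   wavelets. *)
Record cdv_basis (S J0 z0 : nat) (psi : nat -> nat -> R -> R) : Prop := {
  cdv_J0 : (1 <= J0)%N ;
  cdv_z0 : (1 <= z0)%N ;
  cdv_S : (1 <= S <= 2 ^ J0)%N ;
  cdv_L2 : forall l k, (J0 <= l)%N -> (k < card_Z J0 z0 l)%N -> L2 (psi l k) ;
  cdv_orthonormal : forall l k l' k',
    (J0 <= l)%N -> (k < card_Z J0 z0 l)%N ->
    (J0 <= l')%N -> (k' < card_Z J0 z0 l')%N ->
    inner (psi l k) (psi l' k') = ((l == l') && (k == k'))%:R ;
  cdv_complete : forall f, L2 f ->
    norm2 (fun x => f x - \sum_(J0 <= l < N) \sum_(k < card_Z J0 z0 l)
                            inner f (psi l k) * psi l k x)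
      @[N --> \oo] --> (0 : R) ;
  cdv_moments : forall l k m, (J0 < l)%N -> (k < 2 ^ l)%N -> (m < S)%N ->
    inner (fun x => x ^+ m) (psi l k) = 0 ;
  cdv_form : exists (phi psi0 : R -> R) (cL cR : nat -> nat -> R),
    daubechies S phi psi0 /\
    forall l k, (J0 < l)%N -> (k < 2 ^ l)%N ->
      {ae (@lebesgue01 R), forall x, psi l k x = Num.sqrt (2 ^+ l) *
        if (k < S)%N then
          \sum_(i < 4 * S - 2) cL k i *
            phi (2 * (2 ^+ l * x) - (i%:R + 1 - S%:R))
        else if (k < 2 ^ l - S)%N then psi0 (2 ^+ l * x - k%:R)
        else
          \sum_(i < 4 * S - 2) cR (2 ^ l - k.+1)%N i *
            phi (2 * (2 ^+ l * (x - 1)) - (i%:R + 1 - (3 * S)%:R))} }.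

Section Besov.
Variables (J0 z0 : nat) (psi : nat -> nat -> R -> R).

Definition besov_norm (r : R) (f : R -> R) : \bar R :=
  ereal_sup [set (2 `^ (l%:R * r) *
                  Num.sqrt (\sum_(k < card_Z J0 z0 l) inner f (psi l k) ^+ 2))%:E
            | l in [set l | (J0 <= l)%N]].

Definition besov_ball (r B : R) : set (R -> R) :=
  [set f | L2 f /\ (besov_norm r f < B%:E)%E].

Definition besov_ball_sep (s t B rho : R) : set (R -> R) :=
  [set f | besov_ball t B f /\ rho <= dist2 f (besov_ball s B)].

End Besov.
End wavelet_basis.

Section white_noise.
Context {R : realType} {d : measure_display} {Omega : measurableType d}.
Variable P : probability Omega R.

Definition mutually_independent (m : nat) (X : 'I_m -> Omega -> R) : Prop :=
  forall A : 'I_m -> set (measurableTypeR R), (forall i, measurable (A i)) ->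
    P (\big[setI/setT]_(i < m) (X i @^-1` A i)) =
    (\prod_(i < m) P (X i @^-1` A i))%E.

(* Standard Brownian motion on [0,1]; beware that the second parameter of
   normal_prob is the standard deviation. *)
Record brownian_motion (Bm : R -> {RV P >-> R}) : Prop := {
  bm_start : {ae P, forall w, Bm 0 w = 0} ;
  bm_normal : forall x y : R, 0 <= x -> x < y -> y <= 1 ->
    forall A : set (measurableTypeR R), measurable A ->
      pushforward P (Bm y \- Bm x) A = normal_prob 0 (Num.sqrt (y - x)) A ;
  bm_independent : forall (m : nat) (u : nat -> R), 0 <= u 0%N ->
    (forall i, (i < m)%N -> u i <= u i.+1) -> u m <= 1 ->
    mutually_independent (fun i : 'I_m => Bm (u i.+1) \- Bm (u i)) ;
  bm_continuous : {ae P, forall w, {within `[0, 1], continuous (Bm ^~ w)}} }.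

(* W g is the Wiener integral of g in L_2([0,1]) with respect to Bm.  The last
   field is the Gaussian form of the Wiener isometry: integrals of orthonormal
   functions are i.i.d. standard normal. *)
Record wiener_integral (Bm : R -> {RV P >-> R})
    (W : (R -> R) -> {RV P >-> R}) : Prop := {
  wi_indic : forall x : R, 0 <= x <= 1 ->
    {ae P, forall w, W (\1_(`[0, x] : set R)) w = Bm x w} ;
  wi_linear : forall (c : R) (f g : R -> R), L2 f -> L2 g ->
    {ae P, forall w, W (fun x => c * f x + g x) w = c * W f w + W g w} ;
  wi_orthonormal : forall (m : nat) (g : 'I_m -> R -> R),
    (forall i, L2 (g i)) ->
    (forall i i', inner (g i) (g i') = (i == i')%:R) ->
    (forall i (A : set (measurableTypeR R)), measurable A ->
       distribution P (W (g i)) A = normal_prob 0 1 A) /\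
    mutually_independent (fun i => W (g i) : Omega -> R) }.

(* The observation dY = f dx + n^{-1/2} dB, given through the integrals of
   functions g against it. *)
Definition observation (W : (R -> R) -> {RV P >-> R}) (n : R) (f : R -> R)
    (w : Omega) : (R -> R) -> R :=
  fun g => inner f g + W g w / Num.sqrt n.

(* E_f X for a statistic X, i.e. a function of the observation. *)
Definition expect (W : (R -> R) -> {RV P >-> R}) (n : R) (f : R -> R)
    (X : ((R -> R) -> R) -> R) : R :=
  fine 'E_P[fun w => X (observation W n f w)].

End white_noise.

Section test.
Context {R : realType}.
Variables (J0 z0 : nat) (psi : nat -> nat -> R -> R).
Variables (s t B alpha n : R).

(* For j < 0 truncn returns 0 instead of the floor; this is harmless since only
   the case J0 <= j, with 1 <= J0, is considered. *)
Definition level_j : nat := Num.truncn ((2 * t + 2^-1)^-1 * (ln n / ln 2)).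

Definition C_tilde : R :=
  24 * (2 `^ t * B / Num.sqrt (1 - 2 `^ (- (2 * t))) + 19) *
  Num.sqrt (z0%:R / alpha).

Definition rho : R := C_tilde * n `^ (- t / (2 * t + 2^-1)).

Definition tau (l : nat) : R :=
  if l == J0 then 24 * Num.sqrt (z0%:R / alpha) / Num.sqrt n
  else 24 * Num.sqrt (z0%:R / alpha) *
       (2 `^ ((level_j + l)%:R / 8) / Num.sqrt n).

Definition threshold (l : nat) : R := B / 2 `^ (l%:R * s) + tau l / 2.

(* Pi_{W_l} f_n, computed from the observation Y *)
Definition proj_estimate (Y : (R -> R) -> R) (l : nat) : R -> R :=
  fun x => \sum_(k < card_Z J0 z0 l) Y (psi l k) * psi l k x.

Definition T_stat (Y : (R -> R) -> R) (l : nat) : R :=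
  norm2 (proj_estimate Y l) ^+ 2 - (card_Z J0 z0 l)%:R / n.

Definition test_Psi (Y : (R -> R) -> R) : R :=
  1 - \prod_(J0 <= l < level_j.+1) (T_stat Y l < threshold l ^+ 2)%R%:R.

End test.

(* Main.v *)
From HB Require Import structures.
Require Import Defs.
From mathcomp Require Import all_boot all_order all_algebra.
From mathcomp Require Import all_classical all_reals all_analysis.
From mathcomp Require Import measurable_realfun.
From mathcomp Require Import ring lra zify.
Import Order.TTheory GRing.Theory Num.Theory.
Import numFieldNormedType.Exports.
Local Open Scope classical_set_scope.
Local Open Scope ring_scope.
Set Implicit Arguments.
Unset Strict Implicit.

(** At level l the statistic T_n(l) is A_l, the energy of f at that level, plus a
    centred quadratic polynomial in |Z_l| independent standard normal variables,
    of variance at most 8 A_l / n + 254 |Z_l| / n^2.  Chebyshev's inequality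
    bounds the error of the level-l test by h_l = O(alpha 2^(-(j-l)/4)) under
    the null hypothesis, where sqrt A_l < B 2^(-ls), and by 4 h_l when
    sqrt A_l >= B 2^(-ls) + tau_l; a union bound handles the null hypothesis.

    Under the alternative some level l <= j is of the second kind.  Otherwise,
    multiplying each level l <= j of f by a constant so that its norm is at most
    (B - delta) 2^(-ls), and dropping the levels l > j, gives a function of
    Sigma(s, B).  Its squared distance to f is at most the sum of the
    (2 tau_l)^2, plus the energy of f beyond j, which is at most
    B^2 2^(-2t(j+1)) / (1 - 2^(-2t)); this is less than rho_n^2.

    For alpha > 2 there is nothing to prove. *)

(** * Square-integrable functions *)

Section square_integrable.
Context {R : realType} {d : measure_display} {T : measurableType d}.
Variable mu : {measure set T -> \bar R}.
Notation L2mu := (Lfun mu 2%:E).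
Implicit Types f g h : T -> R.

Lemma Lfun2_add f g : f \in L2mu -> g \in L2mu -> (fun x => f x + g x) \in L2mu.
Proof. by have [_ LD] := @Lfun_addr_closed _ _ _ mu _ (lee1n 2); exact: LD. Qed.

Lemma Lfun2_scale (a : R) f : f \in L2mu -> (fun x => a * f x) \in L2mu.
Proof.
move=> fL; rewrite (_ : (fun x => _) = a \o* f); last by apply/funext => x; rewrite /= mulrC.
by apply: Lfun_scale => //; rewrite ler1n.
Qed.

Lemma Lfun2_sub f g : f \in L2mu -> g \in L2mu -> (fun x => f x - g x) \in L2mu.
Proof.
move=> fL gL; rewrite (_ : (fun x => _) = (fun x => f x + (-1) * g x)).
  by apply: Lfun2_add => //; exact: Lfun2_scale.
by apply/funext => x; rewrite mulN1r.
Qed.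

Lemma Lfun2_sum (I : eqType) (r : seq I) (F : I -> T -> R) :
  (forall i, i \in r -> F i \in L2mu) -> (fun x => \sum_(i <- r) F i x) \in L2mu.
Proof.
elim: r => [_|i r IH FL].
  under eq_fun do rewrite big_nil.
  by have [L0 _] := @Lfun_addr_closed _ _ _ mu _ (lee1n 2); exact: L0.
under eq_fun do rewrite big_cons.
apply: Lfun2_add; first by apply: FL; rewrite mem_head.
by apply: IH => j jr; apply: FL; rewrite inE jr orbT.
Qed.

Lemma integrable_mul_Lfun2 f g : f \in L2mu -> g \in L2mu ->
  mu.-integrable setT (EFin \o (fun x => f x * g x)).
Proof. by move=> fL gL; apply/Lfun1_integrable; exact: Lfun2_mul_Lfun1. Qed.

(** The measure is arbitrary because two are used: for [lebesgue01] this is convertible to [inner],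
    and for a probability it is the expectation of a product, so that [ip P X X] is a second
    moment. *)
Definition ip f g : R := (\int[mu]_x (f x * g x))%R.

Lemma ipC f g : ip f g = ip g f.
Proof. by apply: eq_Rintegral => x _; rewrite mulrC. Qed.

Lemma ipDl f g h : f \in L2mu -> g \in L2mu -> h \in L2mu ->
  ip (fun x => f x + g x) h = ip f h + ip g h.
Proof.
move=> fL gL hL; rewrite -RintegralD//; [|exact: integrable_mul_Lfun2..].
by apply: eq_Rintegral => x _; rewrite mulrDl.
Qed.

Lemma ipZl (a : R) f h : f \in L2mu -> h \in L2mu ->
  ip (fun x => a * f x) h = a * ip f h.
Proof.
move=> fL hL; rewrite -RintegralZl//; last exact: integrable_mul_Lfun2.
by apply: eq_Rintegral => x _; rewrite mulrA.
Qed.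

Lemma ipBl f g h : f \in L2mu -> g \in L2mu -> h \in L2mu ->
  ip (fun x => f x - g x) h = ip f h - ip g h.
Proof.
move=> fL gL hL; rewrite -RintegralB//; [|exact: integrable_mul_Lfun2..].
by apply: eq_Rintegral => x _; rewrite mulrBl.
Qed.

Lemma ip_suml (I : eqType) (r : seq I) (F : I -> T -> R) h :
  (forall i, i \in r -> F i \in L2mu) -> h \in L2mu ->
  ip (fun x => \sum_(i <- r) F i x) h = \sum_(i <- r) ip (F i) h.
Proof.
move=> FL hL; elim: r FL => [_|i r IH FL].
  by rewrite big_nil /ip; under eq_Rintegral do rewrite big_nil mul0r;
    rewrite Rintegral_cst// mul0r.
have Fi : F i \in L2mu by apply: FL; rewrite mem_head.
have Fr j : j \in r -> F j \in L2mu by move=> jr; apply: FL; rewrite inE jr orbT.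
rewrite big_cons -IH// -ipDl//; last exact: Lfun2_sum.
by apply: eq_Rintegral => x _; rewrite big_cons.
Qed.

(** Serves twice: for wavelets in the space of functions, and for centred independent variables,
    where it says that variances add up. *)
Lemma ip_pythagoras (I : eqType) (r : seq I) (F : I -> T -> R) :
  uniq r -> (forall i, i \in r -> F i \in L2mu) ->
  (forall i j, i \in r -> j \in r -> i != j -> ip (F i) (F j) = 0) ->
  ip (fun x => \sum_(i <- r) F i x) (fun x => \sum_(i <- r) F i x) =
  \sum_(i <- r) ip (F i) (F i).
Proof.
move=> ur FL orth; rewrite ip_suml//; last exact: Lfun2_sum.
apply: eq_big_seq => i ir; rewrite ipC ip_suml//; last exact: FL.
rewrite (bigD1_seq i)//= big_seq_cond big1 ?addr0// => j /andP[jr ji].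
exact: orth.
Qed.

Lemma sqr_LnormE f : f \in L2mu -> fine ('N[mu]_2%:E[EFin \o f])%E ^+ 2 = ip f f.
Proof.
move=> fL; rewrite unlock /Lnorm.
have -> : (\int[mu]_x `|(EFin \o f) x| `^ 2 = (ip f f)%:E)%E.
  rewrite /ip /Rintegral fineK.
    by apply: eq_integral => x _; rewrite /= powR_mulrn// real_normK// num_real.
  exact/integrable_fin_num/integrable_mul_Lfun2.
rewrite poweR_EFin/= -powR_mulrn ?powR_ge0// -powRrM mulVf// powRr1//.
by apply: Rintegral_ge0 => x _; rewrite -expr2 sqr_ge0.
Qed.

Lemma fine_Lnorm_triangle f g : f \in L2mu -> g \in L2mu ->
  fine ('N[mu]_2%:E[EFin \o (fun x => (f x + g x)%R)])%E <=
  fine ('N[mu]_2%:E[EFin \o f])%E + fine ('N[mu]_2%:E[EFin \o g])%E.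
Proof.
move=> fL gL.
exact: (@ler_LnormD _ _ _ mu _ (lee1n 2) (Lfun_Sub (lee1n 2) fL) (Lfun_Sub (lee1n 2) gL)).
Qed.

End square_integrable.

(** * Moments of the standard normal law *)

Section normal_moments.
Context {R : realType}.
Notation mu := (@lebesgue_measure R).
Notation g := (normal_pdf (0 : R) 1).
Notation N01 := (normal_prob (0 : R) 1).

(** The Gaussian density agrees almost everywhere with the Radon-Nikodym derivative, since both
    integrate to the normal law over every measurable set. *)
Lemma ge0_integral_normal_prob (f : R -> \bar R) :
  measurable_fun [set: R] f -> (forall x, (0 <= f x)%E) ->
  (\int[N01]_x f x = \int[mu]_x (f x * (g x)%:E))%E.
Proof.
move=> mf f0.
have dom := @normal_prob_dominates R 0 1.
rewrite -(Radon_Nikodym_SigmaFinite.change_of_variables dom)//.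
have mg : measurable_fun [set: R] (EFin \o g).
  by apply/measurable_EFinP; exact: measurable_normal_pdf.
have iRN := Radon_Nikodym_SigmaFinite.f_integrable dom.
apply: ae_eq_integral => //.
- by apply: emeasurable_funM => //; exact: measurable_int iRN.
- exact: emeasurable_funM.
- apply: ae_eqe_mul2l => /=; apply: integral_ae_eq => //= E _ mE.
  by rewrite -Radon_Nikodym_SigmaFinite.f_integral.
Qed.

Lemma normal_pdf01E (x : R) : g x = normal_peak 1 * expR (- (x ^+ 2 / 2)).
Proof.
by rewrite normal_pdfE ?oner_neq0// /normal_fun subr0 expr1n mulNr.
Qed.

Lemma normal_pdf01N (x : R) : g (- x) = g x.
Proof. by rewrite !normal_pdf01E sqrrN. Qed.

Lemma is_derive_normal_pdf01 (x : R) : is_derive x 1 g (- x * g x).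
Proof.
have -> : g = (fun y => normal_peak 1 * expR (- (y ^+ 2 / 2))).
  by apply/funext => y; exact: normal_pdf01E.
apply: is_derive_eq.
by rewrite /GRing.scale/=; set e := expR _; field.
Qed.

(* The bound is crude (the fourth moment is 3): it comes from the domination of
   [x ^+ 4] times the density by the density of standard deviation 2, since
   [x ^+ 4 / 64 <= expR (3 / 8 * x ^+ 2)]. *)
Lemma normal_fourth_moment : (\int[N01]_x (x ^+ 4)%:E <= 128%:E)%E.
Proof.
rewrite ge0_integral_normal_prob//; last 2 first.
  by apply/measurable_EFinP; exact: measurable_funX.
  by move=> x; rewrite lee_fin exprn_even_ge0.
pose s : R := 2.
have s0 : s != 0 by rewrite pnatr_eq0.
(* The constant 128 is 64 times this ratio 2 between the heights of the two densities. *)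
have peak : normal_peak (1 : R) = 2 * normal_peak s.
  rewrite /normal_peak expr1n mul1r /s; move: pi => p.
  have -> : (2 : R) ^+ 2 * p *+ 2 = 2 ^+ 2 * (p *+ 2) by ring.
  by rewrite sqrtrM ?sqr_ge0// sqrtr_sqr ger0_norm// invfM mulrA divff ?mul1r.
apply: (@le_trans _ _ (\int[mu]_x (128%:E * (normal_pdf 0 s x)%:E))%E).
  apply: ge0_le_integral => //=.
  - by move=> x _; rewrite lee_fin mulr_ge0 ?normal_pdf_ge0 ?exprn_even_ge0.
  - apply/measurable_EFinP/measurable_funM; first exact: measurable_funX.
    exact: measurable_normal_pdf.
  - apply/measurable_EFinP/measurable_funM; first exact: measurable_cst.
    exact: measurable_normal_pdf.
  - move=> x _; rewrite lee_fin normal_pdf01E normal_pdfE// /normal_fun peak subr0.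
    have -> : - x ^+ 2 / (s ^+ 2 *+ 2) = - (x ^+ 2 / 2) + 3 / 8 * x ^+ 2.
      by rewrite /s; field.
    rewrite expRD; set e := expR (- _).
    rewrite [leLHS](_ : _ = 128 * (normal_peak s * e) * (x ^+ 4 / 64)); last by field.
    rewrite [leRHS](_ : _ = 128 * (normal_peak s * e) * expR (3 / 8 * x ^+ 2)); last by ring.
    apply: ler_wpM2l.
      by rewrite !mulr_ge0 ?expR_ge0 ?normal_peak_ge0.
    have y0 : 0 <= 3 / 8 * x ^+ 2 by rewrite mulr_ge0// sqr_ge0.
    (* With $y = 3x^2/8$, $e^y \ge 1 + y^2/2 = 1 + 9x^4/128$, which exceeds $x^4/64$. *)
    have := @expR_ge1Dxn R _ 1 y0.
    rewrite (_ : (2`!)%:R = 2 :> R)//.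
    nra.
rewrite ge0_integralZl//=; last 2 first.
  - by apply/measurable_EFinP; exact: measurable_normal_pdf.
  - by move=> x _; rewrite lee_fin normal_pdf_ge0.
by rewrite integral_normal_pdf mule1.
Qed.

Lemma normal_pdf01_ge0 (x : R) : 0 <= g x.
Proof. exact: normal_pdf_ge0. Qed.

Lemma continuous_normal_pdf01 : continuous g.
Proof. by apply: continuous_normal_pdf; exact: oner_neq0. Qed.

Lemma is_derive_id_normal_pdf01 (x : R) :
  is_derive x 1 (fun y => y * g y) ((1 - x ^+ 2) * g x).
Proof.
have dg := is_derive_normal_pdf01 x.
apply: is_derive_eq; rewrite /GRing.scale/=; ring.
Qed.

(** With $u = x^2/2$, the function is a constant times $x^{-1} u e^{-u}$, and $u e^{-u} \le 1$. *)
Lemma cvgy_id_normal_pdf01 : x * g x @[x --> +oo] --> (0 : R).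
Proof.
apply: (@squeeze_cvgr _ _ _ _ (cst 0) (fun x => x^-1 * (2 * normal_peak 1))).
- near=> x.
  have x0 : 0 < x by near: x; exact: nbhs_pinfty_gt.
  rewrite mulr_ge0 ?(ltW x0) ?normal_pdf01_ge0//= normal_pdf01E expRN.
  rewrite (_ : x * _ = x^-1 * (2 * normal_peak 1) *
      (x ^+ 2 / 2 * (expR (x ^+ 2 / 2))^-1)); last first.
    by field; rewrite ?gt_eqF ?expR_gt0.
  apply: ler_piMr.
    by rewrite !mulr_ge0 ?invr_ge0 ?(ltW x0) ?normal_peak_ge0.
  rewrite ler_pdivrMr ?expR_gt0// mul1r.
  by rewrite (le_trans _ (expR_ge1Dx _))// lerDr.
- exact: cvg_cst.
- rewrite -(mul0r (2 * normal_peak 1)); apply: cvgMl.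
  apply/gtr0_cvgV0; last exact: cvg_id.
  exact: nbhs_pinfty_gt.
Unshelve. all: by end_near. Qed.

Lemma continuous_mul_normal_pdf01 (h : R -> R) :
  continuous h -> continuous (fun x => h x * g x).
Proof. by move=> ch x; apply: cvgM; [exact: ch|exact: continuous_normal_pdf01]. Qed.

(* [x * g x] is a primitive of [(1 - x ^+ 2) * g x], which has constant sign on
   [0, 1] and on [1, +oo[; adding the two halves cancels the boundary terms. *)
Lemma integral_sqr_normal_pdf01 :
  (\int[mu]_x (x ^+ 2 * g x)%:E = 1)%E.
Proof.
have mg (h : R -> R) : continuous h -> measurable_fun [set: R] (fun x => (h x * g x)%:E).
  move=> ch; apply/measurable_EFinP; apply: continuous_measurable_fun.
  exact: continuous_mul_normal_pdf01.
have c1 : continuous (fun _ : R => 1 : R) by move=> x; exact: cvg_cst.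
have cX : continuous (fun x : R => x ^+ 2) by move=> x; exact: exprn_continuous.
have cB1 : continuous (fun x : R => 1 - x ^+ 2).
  by move=> x; apply: cvgB; [exact: cvg_cst|exact: cX].
have cB2 : continuous (fun x : R => x ^+ 2 - 1).
  by move=> x; apply: cvgB; [exact: cX|exact: cvg_cst].
have cF : continuous (fun x : R => x * g x).
  by apply: continuous_mul_normal_pdf01 => x; exact: cvg_id.
have F1 : (\int[mu]_(x in `[0%R, 1%R]) ((1 - x ^+ 2) * g x)%:E = (g 1)%:E)%E.
  rewrite (@continuous_FTC2 _ _ (fun x => x * g x))//.
  - by rewrite mul0r mul1r sube0.
  - by apply: continuous_subspaceT; exact: continuous_mul_normal_pdf01.
  - split.
    + by move=> x _; case: (is_derive_id_normal_pdf01 x).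
    + by apply: cvg_at_right_filter; exact: cF.
    + by apply: cvg_at_left_filter; exact: cF.
  - by move=> x _; rewrite derive1E; case: (is_derive_id_normal_pdf01 x).
have F2 : (\int[mu]_(x in `[1%R, +oo[) ((x ^+ 2 - 1) * g x)%:E = (g 1)%:E)%E.
  have dF (x : R) : is_derive x 1 (fun x : R => - (x * g x)) ((x ^+ 2 - 1) * g x).
    have d := is_derive_id_normal_pdf01 x.
    by apply: is_derive_eq; ring.
  rewrite (@ge0_continuous_FTC2y _ _ (fun x => - (x * g x)) _ (- 0))//.
  - by rewrite mul1r oppr0 sub0e EFinN oppeK.
  - by move=> x x1; rewrite mulr_ge0 ?normal_pdf01_ge0// subr_ge0 exprn_ege1.
  - by apply: continuous_subspaceT; exact: continuous_mul_normal_pdf01.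
  - apply: cvgN; exact: cvgy_id_normal_pdf01.
  - apply: cvg_at_right_filter; apply: cvgN.
    by exact: cF.
  - by move=> x _; rewrite derive1E; case: (dF x).
have I1 : (\int[mu]_(x in `[0%R, 1%R]) (x ^+ 2 * g x)%:E + (g 1)%:E =
           \int[mu]_(x in `[0%R, 1%R]) (1 * g x)%:E)%E.
  rewrite -F1 -ge0_integralD//=.
  - by apply: eq_integral => x _; rewrite -EFinD; congr EFin; ring.
  - by move=> x _; rewrite lee_fin mulr_ge0 ?sqr_ge0 ?normal_pdf01_ge0.
  - by apply: measurable_funTS; exact: mg.
  - move=> x; rewrite in_itv/= => /andP[x0 x1].
    by rewrite lee_fin mulr_ge0 ?normal_pdf01_ge0// subr_ge0 exprn_ile1.
  - by apply: measurable_funTS; exact: mg.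
have I2 : (\int[mu]_(x in `[1%R, +oo[) (x ^+ 2 * g x)%:E =
           (g 1)%:E + \int[mu]_(x in `[1%R, +oo[) (1 * g x)%:E)%E.
  rewrite -F2 -ge0_integralD//=.
  - by apply: eq_integral => x _; rewrite -EFinD; congr EFin; ring.
  - move=> x; rewrite in_itv/= andbT => x1.
    by rewrite lee_fin mulr_ge0 ?normal_pdf01_ge0// subr_ge0 exprn_ege1.
  - by apply: measurable_funTS; exact: mg.
  - by move=> x _; rewrite lee_fin mul1r normal_pdf01_ge0.
  - by apply: measurable_funTS; exact: mg.
have split_half (h : R -> R) : continuous h -> (forall x, 0 <= h x) ->
    (\int[mu]_(x in [set x | (0 <= x)%R]) (h x * g x)%:E =
     \int[mu]_(x in `[0%R, 1%R]) (h x * g x)%:E +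
     \int[mu]_(x in `[1%R, +oo[) (h x * g x)%:E)%E.
  move=> ch h0; rewrite -integral_itv_bndo_bndc; last first.
    by apply: measurable_funTS; exact: mg.
  rewrite -ge0_integral_setU//=.
  - by rewrite -itv_bndbnd_setU ?bnd_simp ?ler01// set_itvcy.
  - by apply: measurable_funTS; exact: mg.
  - by move=> x _; rewrite lee_fin mulr_ge0 ?normal_pdf01_ge0.
  - apply/disj_setPS => x [/=]; rewrite !in_itv/= => /andP[_ x1] /andP[x1' _].
    by move: (lt_le_trans x1 x1'); rewrite ltxx.
have sym (h : R -> R) : continuous h -> (forall x, 0 <= h x) -> (forall x, h (- x) = h x) ->
    (\int[mu]_x (h x * g x)%:E =
     2%:E * \int[mu]_(x in [set x | (0 <= x)%R]) (h x * g x)%:E)%E.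
  move=> ch h0 hN; apply: ge0_symfun_integralT.
  - by move=> x; rewrite mulr_ge0 ?normal_pdf01_ge0.
  - exact: continuous_mul_normal_pdf01.
  - by move=> x /=; rewrite hN normal_pdf01N.
have X0 (x : R) : 0 <= x ^+ 2 by exact: sqr_ge0.
rewrite sym ?split_half//; last by move=> x; rewrite sqrrN.
rewrite I2 addeA I1 -split_half// -sym//.
by under eq_integral do rewrite mul1r; exact: integral_normal_pdf.
Qed.

Lemma normal_second_moment : (\int[N01]_x (x ^+ 2)%:E = 1)%E.
Proof.
rewrite ge0_integral_normal_prob; first exact: integral_sqr_normal_pdf01.
  by apply/measurable_EFinP; exact: measurable_funX.
by move=> x; rewrite lee_fin sqr_ge0.
Qed.

(** The reflection $x \mapsto -x$ exchanges the positive and negative parts of the identity, so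
    their integrals agree. They cancel because they are finite: $\max(x,0) \le 1 + x^2$. *)
Lemma normal_first_moment : (\int[N01]_x x%:E = 0)%E.
Proof.
have mx : measurable_fun [set: R] (fun x : R => x%:E) by exact/measurable_EFinP.
have Nsym : (\int[N01]_x ((fun x : R => x%:E)^\- x) = \int[N01]_x ((fun x : R => x%:E)^\+ x))%E.
  rewrite !ge0_integral_normal_prob//; last 2 first.
    exact: measurable_funepos.
    exact: measurable_funeneg.
  have mp : measurable_fun [set: R] (fun x : R => ((fun x : R => x%:E)^\+ x * (g x)%:E)%E).
    apply: emeasurable_funM; first exact: measurable_funepos.
    by apply/measurable_EFinP; exact: measurable_normal_pdf.
  rewrite [RHS](eq_measure_integral (pushforward mu (-%R : R -> measurableTypeR R))); last first.
    by move=> A mA _; exact/esym/lebesgue_measureN.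
  rewrite ge0_integral_pushforward//=.
    by apply: eq_integral => x _; rewrite /= normal_pdf01N funeposE funenegE.
  by move=> x _; rewrite mule_ge0// lee_fin normal_pdf01_ge0.
rewrite integralE Nsym subee//.
rewrite ge0_fin_numE ?integral_ge0//.
apply: (@le_lt_trans _ _ (\int[N01]_x (1 + x ^+ 2)%:E)%E).
  apply: ge0_le_integral => //.
  - exact: measurable_funepos.
  - by apply/measurable_EFinP/measurable_funD => //; exact: measurable_funX.
  - move=> x _; rewrite funeposE ge_max !lee_fin.
    by apply/andP; split; nra.
under eq_integral do rewrite EFinD.
rewrite ge0_integralD//=; last 2 first.
  by move=> x _; rewrite lee_fin sqr_ge0.
  by apply/measurable_EFinP; exact: measurable_funX.
by rewrite normal_second_moment integral_cst//= probability_setT mule1 -EFinD ltry.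
Qed.

End normal_moments.

(** * Independence *)

Section independence.
Context {R : realType} {d : measure_display} {T : measurableType d}.
Variable P : probability T R.

(** Independence says that the law of the pair agrees with the product of the marginal laws on
    rectangles, hence everywhere by uniqueness of the product measure. Fubini then splits the
    integral. *)
Lemma ip_independent (X Y : T -> R) :
  X \in Lfun P 2%:E -> Y \in Lfun P 2%:E ->
  (forall A B : set (measurableTypeR R), measurable A -> measurable B ->
    P (X @^-1` A `&` Y @^-1` B) = (P (X @^-1` A) * P (Y @^-1` B))%E) ->
  ip P X Y = (\int[P]_w X w) * (\int[P]_w Y w).
Proof.
move=> XL YL XY.
have /Lfun1_integrable iX := Lfun_subset12 (fin_num_measure P _ measurableT) XL.
have /Lfun1_integrable iY := Lfun_subset12 (fin_num_measure P _ measurableT) YL.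
have iXY := integrable_mul_Lfun2 XL YL.
have mX : measurable_fun [set: T] X by exact/measurable_EFinP/(measurable_int _ iX).
have mY : measurable_fun [set: T] Y by exact/measurable_EFinP/(measurable_int _ iY).
have mp : measurable_fun [set: T] (fun w => (X w, Y w)) by exact: measurable_fun_pair.
pose X' : {mfun T >-> R} := Lfun_Sub (lee1n 2) XL.
pose Y' : {mfun T >-> R} := Lfun_Sub (lee1n 2) YL.
pose Z' : {mfun T >-> (R * R)%type} := HB.pack (fun w => (X w, Y w))
  (isMeasurableFun.Build _ _ _ _ _ mp).
pose m1 := distribution P X'.
pose m2 := distribution P Y'.
pose m' := distribution P Z'.
pose f (z : R * R) : \bar R := (z.1 * z.2)%:E.
have mf : measurable_fun [set: R * R] f.
  by apply/measurable_EFinP; apply: measurable_funM.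
have mE A : measurable A -> (m1 \x m2)%E A = m' A.
  by move=> mA; apply: product_measure_unique => //; exact: XY.
have EXY : (\int[P]_w (X w * Y w)%:E = \int[m1 \x m2]_z f z)%E.
  rewrite (eq_measure_integral m'); last by move=> A mA _; exact: mE.
  by rewrite integral_distribution.
have if_ : (m1 \x m2)%E.-integrable [set: R * R] f.
  apply/integrableP; split=> //.
  rewrite (eq_measure_integral m'); last by move=> A mA _; exact: mE.
  rewrite ge0_integral_distribution//; last exact: measurableT_comp.
  by case/integrableP : iXY.
have mid : measurable_fun [set: R] (fun x : R => x%:E) by exact/measurable_EFinP.
have im2 : m2.-integrable [set: R] (fun x : R => x%:E).
  apply/integrableP; split=> //.
  rewrite ge0_integral_distribution//; last exact: measurableT_comp.
  by case/integrableP : iY.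
have im1 : m1.-integrable [set: R] (fun x : R => x%:E).
  apply/integrableP; split=> //.
  rewrite ge0_integral_distribution//; last exact: measurableT_comp.
  by case/integrableP : iX.
have E1 : (\int[m1]_x x%:E = \int[P]_w (X w)%:E)%E by rewrite integral_distribution.
have E2 : (\int[m2]_x x%:E = \int[P]_w (Y w)%:E)%E by rewrite integral_distribution.
rewrite /ip /Rintegral EXY -integral12_prod_meas1//.
rewrite -fineM; [|exact: integrable_fin_num..].
congr fine; rewrite -E1 -E2.
rewrite -[in RHS](fineK (integrable_fin_num _ im2))//.
rewrite -integralZr//; apply: eq_integral => x _ /=.
rewrite fineK ?integrable_fin_num// /fubini_F /f/=.
by under eq_integral do rewrite EFinM; rewrite integralZl.
Qed.

Lemma mutually_independent_pair (m : nat) (X : 'I_m -> T -> R) (i j : 'I_m) :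
  mutually_independent P X -> i != j ->
  forall A B : set (measurableTypeR R), measurable A -> measurable B ->
  P (X i @^-1` A `&` X j @^-1` B) = (P (X i @^-1` A) * P (X j @^-1` B))%E.
Proof.
move=> indX ij A B mA mB.
(* Taking the whole line for all other indices reduces mutual independence to the pair. *)
pose D (k : 'I_m) : set (measurableTypeR R) :=
  if k == i then A else if k == j then B else setT.
have mD k : measurable (D k) by rewrite /D; case: ifP => // _; case: ifP.
have Di : D i = A by rewrite /D eqxx.
have Dj : D j = B by rewrite /D eq_sym (negbTE ij) eqxx.
have DT k : k != i -> k != j -> D k = setT by rewrite /D => /negbTE -> /negbTE ->.
have := indX D mD.
rewrite (bigD1 i)//= (bigD1 j)/= 1?eq_sym// big1 ?setIT; last first.
  by move=> k /andP[ki kj]; rewrite DT// preimage_setT.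
rewrite (bigD1 i)//= (bigD1 j)/= 1?eq_sym// [X in _ = (_ * (_ * X))%E]big1.
  by rewrite mule1 Di Dj.
by move=> k /andP[ki kj]; rewrite DT// preimage_setT probability_setT.
Qed.

(** Centred and pairwise independent variables are orthogonal for [ip P]. *)
Lemma Rintegral_sum_sqr (m : nat) (Z : 'I_m -> T -> R) :
  (forall i, Z i \in Lfun P 2%:E) -> (forall i, (\int[P]_w Z i w) = 0) ->
  (forall i j, i != j -> forall A B : set (measurableTypeR R),
    measurable A -> measurable B ->
    P (Z i @^-1` A `&` Z j @^-1` B) = (P (Z i @^-1` A) * P (Z j @^-1` B))%E) ->
  ip P (fun w => \sum_i Z i w) (fun w => \sum_i Z i w) = \sum_i ip P (Z i) (Z i).
Proof.
move=> ZL Z0 indZ; rewrite ip_pythagoras ?index_enum_uniq// => i j _ _ ij.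
by rewrite ip_independent// ?Z0 ?mul0r//; exact: indZ.
Qed.

Lemma chebyshev_ip (X : T -> R) (c : R) : X \in Lfun P 2%:E -> 0 < c ->
  (P [set w | c <= `|X w|]%R <= (ip P X X / c ^+ 2)%:E)%E.
Proof.
move=> XL c0.
pose Y : {RV P >-> R} := Lfun_Sub (lee1n 2) XL.
have f_nd : {in Num.nneg &, {homo (fun x : R => x ^+ 2) : x y / x <= y}}.
  by move=> x y; rewrite !nnegrE => x0 y0 xy; rewrite ler_sqr.
have mX2 : measurable_fun [set: R] (fun x : R => x ^+ 2) by exact: measurable_funX.
have := markov Y c0 mX2 (fun r _ => sqr_ge0 r) f_nd.
rewrite unlock => H.
rewrite [leRHS]EFinM lee_pdivlMr ?exprn_gt0// muleC.
rewrite (le_trans _ (le_trans H _))//.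
rewrite /ip /Rintegral fineK ?integrable_fin_num//; last exact: integrable_mul_Lfun2.
rewrite le_eqVlt; apply/orP; left; apply/eqP; apply: eq_integral => w _ /=.
by rewrite real_normK ?num_real.
Qed.

End independence.

(** * Quadratic polynomials in independent normal variables *)

Section gaussian_chaos.
Context {R : realType} {d : measure_display} {T : measurableType d}.
Variable P : probability T R.

Lemma Rintegral_prob_cst (r : R) : (\int[P]_w r) = r.
Proof. by have := expectation_cst P r; rewrite unlock /Rintegral => ->. Qed.

Definition standard_normal (X : {RV P >-> R}) : Prop :=
  forall A : set (measurableTypeR R), measurable A ->
    distribution P X A = normal_prob 0 1 A.

Section one_variable.
Variable X : {RV P >-> R}.
Hypothesis stdX : standard_normal X.

Lemma ge0_integral_standard_normal (f : R -> \bar R) :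
  measurable_fun [set: R] f -> (forall x, (0 <= f x)%E) ->
  (\int[P]_w f (X w) = \int[normal_prob 0 1]_x f x)%E.
Proof.
move=> mf f0.
have mX : measurable_fun [set: T] (X : T -> measurableTypeR R).
  exact: (@measurable_funPT _ _ _ _ X).
rewrite (eq_measure_integral (pushforward P (X : T -> measurableTypeR R))).
  by rewrite ge0_integral_pushforward.
by move=> A mA _; exact/esym/stdX.
Qed.

Lemma Lfun2_sqr_integrable (f : T -> R) : measurable_fun [set: T] f ->
  (\int[P]_w (f w ^+ 2)%:E < +oo)%E -> f \in Lfun P 2%:E.
Proof.
move=> mf fi; rewrite inE; apply/andP; split; rewrite inE//= /finite_norm unlock /Lnorm.
rewrite poweR_lty//; apply: le_lt_trans fi.
rewrite le_eqVlt; apply/orP; left; apply/eqP; apply: eq_integral => w _ /=.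
by rewrite powR_mulrn// real_normK// num_real.
Qed.

Lemma standard_normal_Lfun2 : (X : T -> R) \in Lfun P 2%:E.
Proof.
apply: Lfun2_sqr_integrable => //.
rewrite (ge0_integral_standard_normal (f := fun x => (x ^+ 2)%:E)).
- by rewrite normal_second_moment ltry.
- by apply/measurable_EFinP; exact: measurable_funX.
- by move=> x; rewrite lee_fin sqr_ge0.
Qed.

Lemma standard_normal_sqr_Lfun2 : (fun w => X w ^+ 2) \in Lfun P 2%:E.
Proof.
apply: Lfun2_sqr_integrable; first exact: measurable_funX.
rewrite (eq_integral (fun w => (X w ^+ 4)%:E)); last by move=> w _; rewrite -exprM.
rewrite (ge0_integral_standard_normal (f := fun x => (x ^+ 4)%:E)).
- by rewrite (le_lt_trans (normal_fourth_moment))// ltry.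
- by apply/measurable_EFinP; exact: measurable_funX.
- by move=> x; rewrite lee_fin exprn_even_ge0.
Qed.

Lemma standard_normal_mean : (\int[P]_w X w) = 0.
Proof.
have mX : measurable_fun [set: T] (X : T -> measurableTypeR R).
  exact: (@measurable_funPT _ _ _ _ X).
rewrite /Rintegral (_ : (\int[P]_w (X w)%:E)%E = 0%E)//.
rewrite -normal_first_moment.
rewrite [RHS](eq_measure_integral (pushforward P (X : T -> measurableTypeR R))); last first.
  by move=> A mA _; exact/esym/stdX.
rewrite integral_pushforward//.
apply/Lfun1_integrable; apply: Lfun_subset12; first exact: fin_num_measure.
exact: standard_normal_Lfun2.
Qed.

Lemma standard_normal_sqr_mean : (\int[P]_w X w ^+ 2) = 1.
Proof.
rewrite /Rintegral (ge0_integral_standard_normal (f := fun x => (x ^+ 2)%:E)).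
- by rewrite normal_second_moment.
- by apply/measurable_EFinP; exact: measurable_funX.
- by move=> x; rewrite lee_fin sqr_ge0.
Qed.

Lemma standard_normal_sqr_ip :
  ip P (fun w => X w ^+ 2) (fun w => X w ^+ 2) <= 128.
Proof.
rewrite -lee_fin /ip /Rintegral fineK; last first.
  apply: integrable_fin_num => //; apply: integrable_mul_Lfun2;
  exact: standard_normal_sqr_Lfun2.
rewrite (eq_integral (fun w => (X w ^+ 4)%:E)); last by move=> w _; rewrite -exprD.
rewrite (ge0_integral_standard_normal (f := fun x => (x ^+ 4)%:E)).
- exact: normal_fourth_moment.
- by apply/measurable_EFinP; exact: measurable_funX.
- by move=> x; rewrite lee_fin exprn_even_ge0.
Qed.

Variables a b : R.
(** A combination of the first two Hermite polynomials of X; squaring a noisy coefficient and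
    removing its mean gives such an expression. *)
Definition chaos2 (w : T) : R := a * X w + b * (X w ^+ 2 - 1).

Let X2B1 : (fun w => X w ^+ 2 - 1) \in Lfun P 2%:E.
Proof. by apply: Lfun2_sub; [exact: standard_normal_sqr_Lfun2|exact: Lfun_cst]. Qed.

Lemma chaos2_Lfun2 : chaos2 \in Lfun P 2%:E.
Proof.
by apply: Lfun2_add; apply: Lfun2_scale => //; exact: standard_normal_Lfun2.
Qed.

Let iP (f : T -> R) : f \in Lfun P 2%:E -> P.-integrable setT (EFin \o f).
Proof.
move=> fL; apply/Lfun1_integrable.
exact: (Lfun_subset12 (fin_num_measure P _ measurableT)).
Qed.

Let i1 : P.-integrable setT (EFin \o (fun=> 1 : R)).
Proof. by apply: iP; exact: Lfun_cst. Qed.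

Lemma chaos2_mean : (\int[P]_w chaos2 w) = 0.
Proof.
have XL := standard_normal_Lfun2; have X2L := standard_normal_sqr_Lfun2.
rewrite RintegralD//; last 2 first.
- by apply: iP; exact: Lfun2_scale.
- by apply: iP; exact: Lfun2_scale.
rewrite !RintegralZl//; [|exact: iP..].
rewrite RintegralB//; last exact: iP.
rewrite standard_normal_mean standard_normal_sqr_mean Rintegral_prob_cst.
by rewrite subrr !mulr0 addr0.
Qed.

(** The inequality $(u+v)^2 \le 2u^2 + 2v^2$ avoids the third moment. The fourth moment bound gives
    $E(X^2-1)^2 \le 128 - 2 + 1 = 127$, and 254 is its double. *)
Lemma chaos2_ip : ip P chaos2 chaos2 <= 2 * a ^+ 2 + 254 * b ^+ 2.
Proof.
have XL := standard_normal_Lfun2; have X2L := standard_normal_sqr_Lfun2.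
have ipXX : ip P X X = 1.
  by rewrite -standard_normal_sqr_mean; apply: eq_Rintegral => w _; rewrite expr2.
have c1L : (fun=> 1 : R) \in Lfun P 2%:E by exact: Lfun_cst.
have ipX2 : ip P (fun w => X w ^+ 2 - 1) (fun w => X w ^+ 2 - 1) <= 127.
  rewrite ipBl// ipC ipBl// [X in _ - X]ipC ipBl//.
  have -> : ip P (fun=> 1) (fun w => X w ^+ 2) = 1.
    by rewrite -[RHS]standard_normal_sqr_mean; apply: eq_Rintegral => w _; rewrite mul1r.
  have -> : ip P (fun=> 1) (fun=> 1) = 1.
    by rewrite /ip Rintegral_prob_cst mulr1.
  have -> : ip P (fun w => X w ^+ 2) (fun=> 1) = 1.
    by rewrite -[RHS]standard_normal_sqr_mean; apply: eq_Rintegral => w _; rewrite mulr1.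
  have := standard_normal_sqr_ip; lra.
have iZ (k : R) (f : T -> R) : P.-integrable setT (EFin \o f) ->
    P.-integrable setT (EFin \o (fun w => k * f w)).
  exact: (@integrableZl _ _ _ P _ measurableT k (EFin \o f)).
have iD (f h : T -> R) : P.-integrable setT (EFin \o f) ->
    P.-integrable setT (EFin \o h) -> P.-integrable setT (EFin \o (fun w => f w + h w)).
  exact: (@integrableD _ _ _ P _ measurableT (EFin \o f) (EFin \o h)).
apply: (@le_trans _ _ (\int[P]_w (2 * a ^+ 2 * (X w * X w) +
    2 * b ^+ 2 * ((X w ^+ 2 - 1) * (X w ^+ 2 - 1))))).
  apply: le_Rintegral => //.
  - by apply: integrable_mul_Lfun2; exact: chaos2_Lfun2.
  - by apply: iD; apply: iZ; exact: integrable_mul_Lfun2.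
  - by move=> w _; have := sqr_ge0 (a * X w - b * (X w ^+ 2 - 1)); rewrite /chaos2; nra.
rewrite RintegralD//; last 2 first.
- by apply: iZ; exact: integrable_mul_Lfun2.
- by apply: iZ; exact: integrable_mul_Lfun2.
rewrite !RintegralZl//; [|exact: integrable_mul_Lfun2..].
rewrite -/(ip P X X) -/(ip P (fun w => X w ^+ 2 - 1) (fun w => X w ^+ 2 - 1)) ipXX.
have := sqr_ge0 b; nra.
Qed.

End one_variable.

Lemma chaos2_tail (m : nat) (X : 'I_m -> {RV P >-> R}) (a : 'I_m -> R) (b c : R) :
  (forall i, standard_normal (X i)) ->
  mutually_independent P (fun i => X i : T -> R) -> 0 < c ->
  (P [set w | c <= `|\sum_i chaos2 (X i) (a i) b w|]%R <=
   ((2 * (\sum_i a i ^+ 2) + 254 * b ^+ 2 * m%:R) / c ^+ 2)%:E)%E.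
Proof.
move=> stdX indX c0.
have ZL i : chaos2 (X i) (a i) b \in Lfun P 2%:E by exact: chaos2_Lfun2.
apply: (le_trans (chebyshev_ip _ c0)); first exact: Lfun2_sum.
rewrite lee_fin ler_wpM2r ?invr_ge0 ?sqr_ge0// Rintegral_sum_sqr//.
- have -> : 254 * b ^+ 2 * m%:R = \sum_(i < m) 254 * b ^+ 2.
    by rewrite sumr_const card_ord mulr_natr.
  by rewrite mulr_sumr -big_split/=; apply: ler_sum => i _; exact: chaos2_ip.
- by move=> i; exact: chaos2_mean.
- move=> i j ij A B mA mB.
  (* Each term is a measurable function of one variable, so the independence of the variables passes
     to the terms through preimages. *)
  pose f k (x : R) := a k * x + b * (x ^+ 2 - 1).
  have mf k : measurable_fun [set: R] (f k).
    apply: measurable_funD; apply: measurable_funM => //.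
    by apply: measurable_funB => //; exact: measurable_funX.
  have mpre k (D : set R) : measurable D -> measurable (f k @^-1` D).
    by move=> mD; rewrite -[_ @^-1` _]setTI; exact: mf.
  exact: (mutually_independent_pair indX ij (mpre i A mA) (mpre j B mB)).
Qed.

End gaussian_chaos.

(** * Wavelet sums and the test statistics *)

Section wavelet_sums.
Context {R : realType} {S J0 z0 : nat} {psi : nat -> nat -> R -> R}.
Hypothesis basis : cdv_basis S J0 z0 psi.
Notation card := (card_Z J0 z0).
Notation leb := (@lebesgue01 R).

Lemma sqr_norm2 (f : R -> R) : L2 f -> norm2 f ^+ 2 = inner f f.
Proof. exact: (@sqr_LnormE _ _ _ leb). Qed.

(** With [b l k] equal to [Y (psi l k)] this is convertible to [proj_estimate]. *)
Definition level_sum (b : nat -> nat -> R) (l : nat) : R -> R :=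
  fun x => \sum_(k < card l) b l k * psi l k x.

Definition wavelet_sum (b : nat -> nat -> R) (r : seq nat) : R -> R :=
  fun x => \sum_(l <- r) level_sum b l x.

Lemma psi_term_L2 (a : R) l (k : 'I_(card l)) : (J0 <= l)%N ->
  (fun x => a * psi l k x) \in Lfun leb 2%:E.
Proof. by move=> l0; apply: Lfun2_scale; exact: (cdv_L2 basis). Qed.

Lemma level_sum_L2 b l : (J0 <= l)%N -> level_sum b l \in Lfun leb 2%:E.
Proof.
by move=> l0; apply: (@Lfun2_sum _ _ _ leb 'I_(card l)) => k _; exact: psi_term_L2.
Qed.

Lemma wavelet_sum_L2 b r : all (leq J0) r -> wavelet_sum b r \in Lfun leb 2%:E.
Proof.
by move=> /allP r0; apply: (@Lfun2_sum _ _ _ leb nat) => l /r0; exact: level_sum_L2.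
Qed.

Lemma inner_level_psi b l l' k' : (J0 <= l)%N -> (J0 <= l')%N -> (k' < card l')%N ->
  inner (level_sum b l) (psi l' k') = if l == l' then b l' k' else 0.
Proof.
move=> l0 l0' k'l'; have pL := cdv_L2 basis l0' k'l'.
rewrite [LHS](@ip_suml _ _ _ leb 'I_(card l)) => [|k _|//]; last exact: psi_term_L2.
rewrite (eq_bigr (fun k : 'I_(card l) => b l k * ((l == l') && (k == k' :> nat))%:R)); last first.
  move=> k _; rewrite ipZl//; last exact: (cdv_L2 basis).
  by rewrite -(cdv_orthonormal basis).
case: eqP => [->|_]/=; last by rewrite big1// => k _; rewrite mulr0.
rewrite (bigD1 (Ordinal k'l'))//= eqxx mulr1 big1 ?addr0// => k kk'.
by rewrite (_ : (k == k' :> nat) = false) ?mulr0//; apply/negbTE.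
Qed.

Lemma inner_wavelet_psi b r l' k' : uniq r -> all (leq J0) r ->
  (J0 <= l')%N -> (k' < card l')%N ->
  inner (wavelet_sum b r) (psi l' k') = if l' \in r then b l' k' else 0.
Proof.
move=> ur /allP r0 l0' k'l'.
rewrite [LHS](@ip_suml _ _ _ leb nat); last exact: (cdv_L2 basis).
  rewrite (eq_big_seq (fun l => if l == l' then b l' k' else 0)); last first.
    by move=> l lr; apply: inner_level_psi => //; exact: r0.
  case: ifPn => lr.
    rewrite (bigD1_seq l')//= eqxx big1_seq ?addr0// => l /andP[/negbTE -> _//].
  rewrite big1_seq// => l /andP[_ lr2]; case: eqP => // ll'.
  by rewrite -ll' lr2 in lr.
by move=> l /r0; exact: level_sum_L2.
Qed.

Lemma inner_level_self b l : (J0 <= l)%N ->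
  inner (level_sum b l) (level_sum b l) = \sum_(k < card l) b l k ^+ 2.
Proof.
move=> l0.
have psiL (k : 'I_(card l)) := cdv_L2 basis l0 (ltn_ord k).
have E (k k' : 'I_(card l)) : ip leb (fun x => b l k * psi l k x) (fun x => b l k' * psi l k' x)
    = b l k * b l k' * (k == k')%:R.
  rewrite ipZl; [|exact: psiL|exact: psi_term_L2].
  rewrite ipC ipZl; [|exact: psiL..].
  rewrite mulrA; congr (_ * _).
  by rewrite [LHS](cdv_orthonormal basis)// eqxx eq_sym.
rewrite [LHS](@ip_pythagoras _ _ _ leb 'I_(card l) _ _ (index_enum_uniq _)).
- by apply: eq_bigr => k _; rewrite E eqxx mulr1 expr2.
- by move=> k _; exact: psi_term_L2.
- by move=> k k' _ _ /negbTE kk'; rewrite E kk' mulr0.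
Qed.

Lemma inner_wavelet_self b r : uniq r -> all (leq J0) r ->
  inner (wavelet_sum b r) (wavelet_sum b r) = \sum_(l <- r) \sum_(k < card l) b l k ^+ 2.
Proof.
move=> ur /allP r0.
rewrite [LHS](@ip_pythagoras _ _ _ leb nat _ _ ur).
- by apply: eq_big_seq => l /r0; exact: inner_level_self.
- by move=> l /r0; exact: level_sum_L2.
- move=> l l' /r0 l0 /r0 l0' ll'; rewrite ipC.
  rewrite [LHS](@ip_suml _ _ _ leb 'I_(card l')) => [|k _|].
  + rewrite big1// => k _; rewrite ipZl; [|exact: (cdv_L2 basis)|exact: level_sum_L2].
    by rewrite ipC [ip _ _ _]inner_level_psi// (negbTE ll') mulr0.
  + exact: psi_term_L2.
  + exact: level_sum_L2.
Qed.

Lemma sqr_norm2_proj_estimate (Y : (R -> R) -> R) l : (J0 <= l)%N ->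
  norm2 (proj_estimate J0 z0 psi Y l) ^+ 2 = \sum_(k < card l) Y (psi l k) ^+ 2.
Proof.
move=> l0; rewrite sqr_norm2; last exact: (level_sum_L2 (fun l k => Y (psi l k))).
exact: (inner_level_self (fun l k => Y (psi l k))).
Qed.

(** By orthonormality, the squared norm of the projection of f onto $W_l$. *)
Definition level_energy (f : R -> R) (l : nat) : R :=
  \sum_(k < card l) inner f (psi l k) ^+ 2.

Lemma level_energy_ge0 f l : 0 <= level_energy f l.
Proof. by apply: sumr_ge0 => k _; exact: sqr_ge0. Qed.

Lemma besov_ball_level (r B : R) f l : (J0 <= l)%N -> besov_ball J0 z0 psi r B f ->
  Num.sqrt (level_energy f l) < B / 2 `^ (l%:R * r).
Proof.
move=> l0 [_ fB]; rewrite ltr_pdivlMr ?powR_gt0// mulrC -lte_fin.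
by apply: le_lt_trans fB; apply: ereal_sup_ubound; exists l.
Qed.

(** * Law of the statistics under the white noise model *)

Section noise.
Context {d : measure_display} {Omega : measurableType d}.
Variables (P : probability Omega R) (Bm : R -> {RV P >-> R}).
Variables (W : (R -> R) -> {RV P >-> R}).
Hypothesis WI : wiener_integral Bm W.
Variable n : R.
Hypothesis n0 : 0 < n.

(** For each coefficient, $(a + e/\sqrt n)^2 - 1/n = a^2 + (2a/\sqrt n)\,e + (e^2 - 1)/n$. *)
Lemma T_stat_chaos (f : R -> R) l w : (J0 <= l)%N ->
  T_stat J0 z0 psi n (observation W n f w) l =
  level_energy f l +
  \sum_(k < card l) chaos2 (W (psi l k)) (2 * inner f (psi l k) / Num.sqrt n) n^-1 w.
Proof.
move=> l0; rewrite /T_stat sqr_norm2_proj_estimate// /level_energy -big_split/=.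
have -> : (card l)%:R / n = \sum_(k < card l) n^-1.
  by rewrite sumr_const card_ord mulr_natl.
rewrite -sumrB; apply: eq_bigr => k _; rewrite /observation /chaos2.
set e := W _ w; set a := inner _ _.
have -> : n^-1 = (Num.sqrt n)^-1 ^+ 2 by rewrite exprVn sqr_sqrtr// ltW.
by ring.
Qed.

(** The noise in an orthonormal family is i.i.d. standard normal, so [chaos2_tail] applies; the
    linear coefficients $2a/\sqrt n$ contribute $2 \cdot 4/n$ times the energy. *)
Lemma T_stat_tail (f : R -> R) l (c : R) : (J0 <= l)%N -> 0 < c ->
  (P [set w | c <= `|T_stat J0 z0 psi n (observation W n f w) l - level_energy f l|]%R <=
   ((8 / n * level_energy f l + 254 * (card l)%:R / n ^+ 2) / c ^+ 2)%:E)%E.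
Proof.
move=> l0 c0.
have orth (k k' : 'I_(card l)) : inner (psi l k) (psi l k') = (k == k')%:R.
  by rewrite (cdv_orthonormal basis)// eqxx.
have [stdW indW] := wi_orthonormal WI (fun k => cdv_L2 basis l0 (ltn_ord k)) orth.
have := chaos2_tail (fun k => 2 * inner f (psi l k) / Num.sqrt n) n^-1 stdW indW c0.
congr (P _ <= _%:E)%E.
  by apply/seteqP; split => w /=; rewrite T_stat_chaos// addrC addKr.
congr (_ / _).
rewrite (eq_bigr (fun k : 'I_(card l) => 4 / n * inner f (psi l k) ^+ 2)); last first.
  by move=> k _; rewrite !exprMn exprVn sqr_sqrtr ?(ltW n0)//; ring.
rewrite -mulr_sumr -/(level_energy f l); field.
by rewrite gt_eqF.
Qed.

Lemma measurable_T_stat (f : R -> R) l : (J0 <= l)%N ->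
  measurable_fun [set: Omega] (fun w => T_stat J0 z0 psi n (observation W n f w) l).
Proof.
move=> l0; under eq_fun do rewrite T_stat_chaos//.
apply: measurable_funD => //; apply: measurable_sum => k.
apply: measurable_funD; apply: measurable_funM => //.
by apply: measurable_funB => //; exact: measurable_funX.
Qed.

End noise.
End wavelet_sums.

Arguments level_sum {R} J0 z0 psi b l _.
Arguments wavelet_sum {R} J0 z0 psi b r _.
Arguments level_energy {R} J0 z0 psi f l.

(** * Numerical bounds *)

Section numerics.
Context {R : realType}.

(** Above the first level, $\tau_l^2$ is proportional to $2^{(j+l)/4}$; with this base all exponents
    become natural numbers. *)
Definition root4 : R := 2 `^ (4^-1).
Notation p := root4.

Lemma root4_pow4 : p ^+ 4 = 2.
Proof. by rewrite -powR_mulrn ?powR_ge0// -powRrM mulVf// powRr1. Qed.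

Lemma root4_gt0 : 0 < p.
Proof. exact: powR_gt0. Qed.

Lemma sqr_root8 (m : nat) : (2 `^ (m%:R / 8) : R) ^+ 2 = p ^+ m.
Proof.
have E (r : R) k : (2 `^ r) ^+ k = 2 `^ (r * k%:R) by rewrite powRrM powR_mulrn// powR_ge0.
by rewrite /root4 !E; congr (_ `^ _); field.
Qed.

Lemma root4_expR (m : nat) : p ^+ m = expR (4^-1 * m%:R * ln 2).
Proof. by rewrite -powR_mulrn ?powR_ge0// -powRrM /powR pnatr_eq0. Qed.

Local Opaque root4.

(** Indeed $(7/6)^4 = 2401/1296 < 2$. The value is chosen so that a geometric series of ratio $1/p$
    sums to at most $1/(1 - 6/7) = 7$. *)
Lemma root4_ge : 7 / 6 <= p.
Proof.
rewrite leNgt; apply/negP => plt.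
have p0 := root4_gt0; have p4 := root4_pow4.
have : p ^+ 4 < (7 / 6) ^+ 4 by rewrite ltrXn2r// ?ltW// divr_ge0.
rewrite p4; lra.
Qed.

Lemma root4_ge1 : 1 <= p.
Proof. have := root4_ge; lra. Qed.

(** Passing from j to j+1 multiplies the sum by $1/p \le 6/7$ and adds 1, and 7 is the fixed point
    of $y \mapsto 6y/7 + 1$. *)
Lemma geometric_sum_le (a j : nat) :
  \sum_(a <= l < j.+1) p^-1 ^+ (j - l) <= 7.
Proof.
have p0 := root4_gt0; have pge := root4_ge.
have q0 : 0 <= p^-1 by rewrite invr_ge0 ltW.
have q1 : p^-1 <= 6 / 7.
  by rewrite -[6 / 7]invf_div lef_pV2// posrE.
elim: j => [|j IH].
  have [a0|a0] := leqP a 0; last by rewrite big_geq.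
  by rewrite big_nat_recr//= big_geq// add0r expr0 ler1n.
have [aj|aj] := leqP a j.+1; last by rewrite big_geq.
rewrite big_nat_recr//= subnn expr0.
rewrite (eq_big_nat _ _ (F2 := fun l => p^-1 * p^-1 ^+ (j - l))); last first.
  by move=> l /andP[_ lj]; rewrite subSn// exprS.
rewrite -mulr_sumr.
apply: (@le_trans _ _ (6 / 7 * 7 + 1)); last lra.
rewrite lerD2r; apply: ler_pM => //.
by apply: sumr_ge0 => l _; rewrite exprn_ge0.
Qed.

Lemma sum_root4_le (a j : nat) :
  \sum_(a <= l < j.+1) p ^+ (j + l) <= 7 * p ^+ (2 * j).
Proof.
have p0 := root4_gt0.
rewrite (eq_big_nat _ _ (F2 := fun l => p ^+ (2 * j) * p^-1 ^+ (j - l))).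
  rewrite -mulr_sumr mulrC; apply: ler_wpM2r; last exact: geometric_sum_le.
  by apply: exprn_ge0; exact: ltW.
move=> l /andP[_ lj]; rewrite exprVn (_ : (2 * j = (j + l) + (j - l))%N); last by lia.
by rewrite [in RHS]exprD mulfK// expf_neq0// gt_eqF.
Qed.

Lemma geometric_tail_le (w : R) (a b : nat) : 0 <= w < 1 ->
  \sum_(a <= l < b) w ^+ l <= w ^+ a / (1 - w).
Proof.
move=> /andP[w0 w1]; have w1' : 0 < 1 - w by rewrite subr_gt0.
rewrite ler_pdivlMr//.
have [ab|ab] := leqP a b; last first.
  by rewrite big_geq ?(ltnW ab)// mul0r exprn_ge0.
rewrite (_ : _ * _ = w ^+ a - w ^+ b); first by rewrite gerBl exprn_ge0.
rewrite mulrC mulr_sumr.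
rewrite (eq_bigr (fun l => - (w ^+ l.+1 - w ^+ l))); last by move=> l _; rewrite exprS; ring.
by rewrite sumrN telescope_sumr// opprB.
Qed.

(** Here x is the norm of f at a level, the numerator a variance and the denominator the squared gap
    to the threshold. Since $b \ge x$, the gap is at least $x\tau + \tau^2/4$, whose square
    dominates $x^2\tau^2 + \tau^4/16$; the first term absorbs $u x^2$ and the second absorbs v. *)
Lemma quotient_le_null (u v x b tau : R) : 0 <= u -> 0 <= v -> 0 <= x <= b -> 0 < tau ->
  (u * x ^+ 2 + v) / ((b + tau / 2) ^+ 2 - x ^+ 2) ^+ 2 <=
  u / tau ^+ 2 + 16 * (v / tau ^+ 4).
Proof.
move=> u0 v0 /andP[x0 xb] t0.
have c1 : x * tau + tau ^+ 2 / 4 <= (b + tau / 2) ^+ 2 - x ^+ 2 by nra.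
have c0 : 0 < x * tau + tau ^+ 2 / 4 by rewrite ltr_wpDl ?divr_gt0 ?exprn_gt0// mulr_ge0// ltW.
rewrite ler_pdivrMr ?exprn_gt0 ?(lt_le_trans c0)//.
have c2 : x ^+ 2 * tau ^+ 2 + tau ^+ 4 / 16 <= ((b + tau / 2) ^+ 2 - x ^+ 2) ^+ 2.
  apply: (@le_trans _ _ ((x * tau + tau ^+ 2 / 4) ^+ 2)).
    rewrite -subr_ge0 (_ : _ - _ = x * tau ^+ 3 / 2); last by field.
    by rewrite divr_ge0// mulr_ge0// exprn_ge0// ltW.
  by rewrite ler_sqr ?nnegrE// ltW// (lt_le_trans c0).
have U0 : 0 <= u / tau ^+ 2 by rewrite divr_ge0// sqr_ge0.
have V0 : 0 <= v / tau ^+ 4 by rewrite divr_ge0// exprn_even_ge0.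
rewrite mulrDl; apply: lerD.
  apply: (@le_trans _ _ (u / tau ^+ 2 * (x ^+ 2 * tau ^+ 2))).
    by rewrite le_eqVlt; apply/orP; left; apply/eqP; field; rewrite gt_eqF.
  by rewrite ler_wpM2l// (le_trans _ c2)// lerDl divr_ge0// exprn_even_ge0.
apply: (@le_trans _ _ (16 * (v / tau ^+ 4) * (tau ^+ 4 / 16))).
  by rewrite le_eqVlt; apply/orP; left; apply/eqP; field; rewrite gt_eqF.
apply: ler_wpM2l; first by rewrite mulr_ge0.
by rewrite (le_trans _ c2)// lerDr mulr_ge0 ?sqr_ge0.
Qed.

(** The gap factors as $(x - b - \tau/2)(x + b + \tau/2) \ge x\tau/2$. Its square $x^2\tau^2/4$
    handles $u x^2$, and, as $x \ge \tau$, is also at least $\tau^4/4$, which handles v with room to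
    spare. *)
Lemma quotient_le_alternative (u v x b tau : R) :
  0 <= u -> 0 <= v -> 0 <= b -> 0 < tau -> b + tau <= x ->
  (u * x ^+ 2 + v) / (x ^+ 2 - (b + tau / 2) ^+ 2) ^+ 2 <=
  4 * (u / tau ^+ 2 + 16 * (v / tau ^+ 4)).
Proof.
move=> u0 v0 b0 t0 xb.
have x0 : 0 < x by lra.
have c1 : x * tau / 2 <= x ^+ 2 - (b + tau / 2) ^+ 2 by nra.
have c0 : 0 < x * tau / 2 by rewrite !mulr_gt0// invr_gt0.
rewrite ler_pdivrMr ?exprn_gt0 ?(lt_le_trans c0)//.
have c2 : x ^+ 2 * tau ^+ 2 / 4 <= (x ^+ 2 - (b + tau / 2) ^+ 2) ^+ 2.
  apply: (@le_trans _ _ ((x * tau / 2) ^+ 2)).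
    by rewrite le_eqVlt; apply/orP; left; apply/eqP; field.
  by rewrite ler_sqr ?nnegrE// ltW// (lt_le_trans c0).
have U0 : 0 <= u / tau ^+ 2 by rewrite divr_ge0// sqr_ge0.
have V0 : 0 <= v / tau ^+ 4 by rewrite divr_ge0// exprn_even_ge0.
rewrite (_ : 4 * _ * _ = 4 * (u / tau ^+ 2) * (x ^+ 2 - (b + tau / 2) ^+ 2) ^+ 2 +
   64 * (v / tau ^+ 4) * (x ^+ 2 - (b + tau / 2) ^+ 2) ^+ 2); last by ring.
apply: lerD.
  apply: (@le_trans _ _ (4 * (u / tau ^+ 2) * (x ^+ 2 * tau ^+ 2 / 4))).
    by rewrite le_eqVlt; apply/orP; left; apply/eqP; field; rewrite gt_eqF.
  by apply: ler_wpM2l => //; rewrite mulr_ge0.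
apply: (@le_trans _ _ (64 * (v / tau ^+ 4) * (tau ^+ 4 / 4))).
  rewrite (_ : 64 * _ * _ = 16 * v); last by field; rewrite gt_eqF.
  by lra.
apply: ler_wpM2l; first by rewrite mulr_ge0.
rewrite (le_trans _ c2)//.
rewrite ler_pM2r// (_ : tau ^+ 4 = tau ^+ 2 * tau ^+ 2); last by rewrite -exprD.
rewrite ler_pM2r ?exprn_gt0// ler_sqr ?nnegrE ?(ltW t0) ?(ltW x0)//.
lra.
Qed.

(** * Choice of the maximal level and of the thresholds *)

Section calibration.
Variables (t n : R).
Hypotheses (t0 : 0 < t) (n0 : 0 < n) (j1 : (1 <= level_j t n)%N).
Notation j := (level_j t n).
Notation rate := (n `^ (- t / (2 * t + 2^-1))).
Let x := (2 * t + 2^-1)^-1 * (ln n / ln 2).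

Let T0 : 0 < 2 * t + 2^-1 :> R.
Proof. by rewrite addr_gt0// ?invr_gt0// mulr_gt0. Qed.

Let ln2 : 0 < ln 2 :> R.
Proof. by rewrite ln_gt0// ltr1n. Qed.

Let jx : j%:R <= x < j.+1%:R.
Proof.
(* Since j is positive, [truncn] is the true integer part of x and not its default value 0. *)
have x1 : 1 <= x by rewrite -truncn_gt0.
by apply: truncn_itv; rewrite (le_trans ler01).
Qed.

Let lnn : ln n = (2 * t + 2^-1) * x * ln 2.
Proof. by rewrite /x mulVKf ?gt_eqF// divfK// gt_eqF. Qed.

Let rateE : rate = expR (- t * x * ln 2).
Proof.
rewrite /powR gt_eqF// lnn; congr expR.
have E (u v y z : R) : v != 0 -> u / v * (v * y * z) = u * y * z by move=> v0; field.
by rewrite E// gt_eqF.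
Qed.

(** The noise side of the trade-off: as $j \le x$ and $2^x = n^{1/(2t+1/2)}$, the left side
    $2^{j/2}/n$ is at most $n^{-2t/(2t+1/2)}$. *)
Lemma root4_rate : p ^+ (2 * j) / n <= rate ^+ 2.
Proof.
rewrite root4_expR natrM.
have -> : n^-1 = expR (- ln n) by rewrite expRN lnK.
rewrite rateE -expRM_natr -expRD ler_expR lnn.
have /andP[jx1 _] := jx.
have : j%:R * ln 2 <= x * ln 2 by rewrite ler_pM2r.
lra.
Qed.

(** The approximation side of the trade-off, which rests on $x < j+1$. *)
Lemma tail_rate : (2 `^ (- (2 * t))) ^+ j.+1 <= rate ^+ 2.
Proof.
rewrite rateE -expRM_natr -powR_mulrn ?powR_ge0// -powRrM /powR pnatr_eq0/= ler_expR.
have /andP[_ jx1] := jx.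
have : t * x * ln 2 <= t * j.+1%:R * ln 2.
  by rewrite ler_pM2r// ler_pM2l// ltW.
lra.
Qed.

Variables (z0 J0 : nat) (alpha : R).
Hypotheses (z01 : (1 <= z0)%N) (a0 : 0 < alpha) (a2 : alpha <= 2).
Notation D := (24 * Num.sqrt (z0%:R / alpha)).
Notation tau := (tau J0 z0 t alpha n).

Lemma sqr_tau l : tau l ^+ 2 =
  576 * (z0%:R / alpha) * (if l == J0 then 1 else p ^+ (j + l)) / n.
Proof.
have za0 : 0 <= z0%:R / alpha by rewrite divr_ge0// ltW.
rewrite /Defs.tau; case: eqP => _.
  rewrite mulr1 !exprMn exprVn !sqr_sqrtr ?(ltW n0)//.
  by congr (_ * _ / _); ring.
rewrite !exprMn exprVn !sqr_sqrtr ?(ltW n0)// mulrA; congr (_ * _ / _).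
  by congr (_ * _); ring.
exact: sqr_root8.
Qed.

Lemma tau_gt0 l : 0 < tau l.
Proof.
have za0 : 0 < z0%:R / alpha by rewrite divr_gt0// ltr0n.
rewrite /Defs.tau; case: eqP => _.
  by rewrite divr_gt0 ?sqrtr_gt0// mulr_gt0 ?sqrtr_gt0.
apply: mulr_gt0; first by rewrite mulr_gt0 ?sqrtr_gt0.
by rewrite divr_gt0 ?powR_gt0 ?sqrtr_gt0.
Qed.

(* The bound of [quotient_le_null] for [u = 8 / n] and [v = 254 * |Z_l| / n ^+ 2],
   the coefficients of the variance bound in [T_stat_tail]. *)
Definition level_risk l := 8 / n / tau l ^+ 2 +
  16 * (254 * (card_Z J0 z0 l)%:R / n ^+ 2 / tau l ^+ 4).

(** Put $q = p^{-(j-l)}$. Above the first level $|Z_l| = p^{4l}$, and $\tau_l^2$ is of order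
    $p^{j+l}$: the first term of the risk is of order $p^{-(j+l)} = q\,p^{-2l} \le q$ and the second
    of order $q^2 \le q$. *)
Lemma level_risk_le l : (J0 <= l <= j)%N ->
  level_risk l <= alpha / 24 * (if l == J0 then 1 else p^-1 ^+ (j - l)).
Proof.
move=> /andP[l0 lj]; rewrite /level_risk.
have -> : tau l ^+ 4 = (tau l ^+ 2) ^+ 2 by rewrite -exprM.
have z1 : 1 <= z0%:R :> R by rewrite ler1n.
have zi1 : z0%:R^-1 <= 1 :> R by rewrite invf_le1// (lt_le_trans ltr01).
have zi0 : 0 < z0%:R^-1 :> R by rewrite invr_gt0 (lt_le_trans ltr01).
have zn0 : z0%:R != 0 :> R by rewrite gt_eqF// (lt_le_trans ltr01).
have az : alpha * z0%:R^-1 <= alpha by rewrite ler_piMr// ltW.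
(* The coefficients of [level_risk] divided by $24^2$ and $24^4$. The second comes with an extra
   factor $\alpha \le 2$, and [k12] is where the constant 24 in the thresholds is large enough. *)
pose k1 : R := 8 / 576; pose k2 : R := 16 * 254 / (576 * 576).
have k10 : 0 <= k1 by rewrite /k1; lra.
have k20 : 0 <= k2 by rewrite /k2; lra.
have k12 : k1 + k2 * 2 <= 24^-1 by rewrite /k1 /k2; lra.
rewrite sqr_tau /card_Z; case: eqP => [lJ|lJ].
  rewrite !mulr1.
  rewrite [leLHS](_ : _ = alpha * z0%:R^-1 * (k1 + k2 * alpha)); last first.
    by rewrite /k1 /k2; field; rewrite !gt_eqF// (lt_le_trans ltr01).
  clearbody k1 k2.
  have az0 : 0 <= alpha * z0%:R^-1 by apply: mulr_ge0; exact: ltW.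
  have ka : k2 * alpha <= k2 * 2 by exact: ler_wpM2l.
  have ka0 : 0 <= k2 * alpha by apply: mulr_ge0 => //; exact: ltW.
  apply: ler_pM; [exact: az0|exact: addr_ge0|exact: az|].
  by apply: le_trans k12; rewrite lerD2l.
have pn0 m : p ^+ m != 0 by rewrite expf_neq0// gt_eqF// root4_gt0.
set q := p^-1 ^+ (j - l).
have q0 : 0 < q by rewrite exprn_gt0// invr_gt0 root4_gt0.
have q1 : q <= 1.
  by rewrite exprn_ile1 ?invr_ge0 ?(ltW root4_gt0)// invf_le1 ?root4_ge1// root4_gt0.
have jl : p ^+ j = p ^+ l / q.
  by rewrite /q exprVn invrK -exprD subnKC.
have pl1 : (p ^+ l)^-1 <= 1.
  by rewrite invf_le1 ?exprn_gt0 ?root4_gt0// exprn_ege1// root4_ge1.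
have pl0 : 0 < (p ^+ l)^-1 by rewrite invr_gt0 exprn_gt0 ?root4_gt0.
have -> : (2 ^ l)%:R = (p ^+ l) ^+ 4 :> R.
  by rewrite -exprM mulnC exprM root4_pow4 natrX.
have plN0 : p ^+ l != 0 by exact: pn0.
rewrite exprD jl; clearbody q; move: (p ^+ l) pl1 pl0 plN0 => y pl1 pl0 plN0.
rewrite [leLHS](_ : _ = alpha * z0%:R^-1 * q *
    (k1 * y^-1 ^+ 2 + k2 * (alpha * z0%:R^-1) * q)); last first.
  by rewrite /k1 /k2; field; rewrite plN0 zn0 !gt_eqF.
clearbody k1 k2.
have az0 : 0 <= alpha * z0%:R^-1 by apply: mulr_ge0; exact: ltW.
rewrite [leRHS]mulrAC.
apply: ler_pM.
- by apply: mulr_ge0 => //; exact: ltW.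
- apply: addr_ge0; first by apply: mulr_ge0 => //; exact: sqr_ge0.
  by apply: mulr_ge0; [exact: mulr_ge0|exact: ltW].
- by apply: ler_wpM2r => //; exact: ltW.
- apply: le_trans k12; apply: lerD.
    apply: ler_piMr => //; apply: exprn_ile1 => //; exact: ltW.
  rewrite -mulrA; apply: ler_wpM2l => //.
  rewrite -[leRHS]mulr1; apply: ler_pM => //; first exact: ltW.
  exact: le_trans az a2.
Qed.

(** The first level counts for 1 and the geometric sum over the others for at most 7, in units of
    $\alpha/24$. *)
Lemma sum_level_risk_le : (J0 <= j)%N ->
  \sum_(J0 <= l < j.+1) level_risk l <= alpha / 3.
Proof.
move=> J0j.
apply: (@le_trans _ _ (\sum_(J0 <= l < j.+1)
    alpha / 24 * (if l == J0 then 1 else p^-1 ^+ (j - l)))).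
  rewrite big_nat_cond [leRHS]big_nat_cond; apply: ler_sum => l /andP[/andP[l0 lj] _].
  by apply: level_risk_le; rewrite l0.
rewrite -mulr_sumr big_ltn ?ltnS// eqxx.
rewrite (eq_big_nat _ _ (F2 := fun l => p^-1 ^+ (j - l))); last first.
  by move=> l /andP[l0 _]; rewrite gtn_eqF.
have := geometric_sum_le J0.+1 j; move: (\sum_(_ <= _ < _) _) => g g7.
have : 0 <= alpha * (7 - g) by rewrite mulr_ge0 ?subr_ge0// ltW.
lra.
Qed.

Lemma sum_sqr_tau_le : \sum_(J0 <= l < j.+1) tau l ^+ 2 <= 7 * D ^+ 2 * rate ^+ 2.
Proof.
have za0 : 0 <= z0%:R / alpha by rewrite divr_ge0// ltW.
have D2 : D ^+ 2 = 576 * (z0%:R / alpha).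
  by rewrite exprMn sqr_sqrtr//; congr (_ * _); ring.
have tauE l : tau l ^+ 2 = D ^+ 2 / n * (if l == J0 then 1 else p ^+ (j + l)).
  by rewrite sqr_tau D2 mulrAC.
have := sqr_ge0 D; move: (D ^+ 2) tauE => K tauE K0.
have Kn0 : 0 <= K / n by apply: divr_ge0 => //; exact: ltW.
apply: (@le_trans _ _ (\sum_(J0 <= l < j.+1) K / n * p ^+ (j + l))).
  rewrite big_nat_cond [leRHS]big_nat_cond; apply: ler_sum => l /andP[/andP[l0 lj] _].
  rewrite tauE; apply: ler_wpM2l; first exact: Kn0.
  by case: eqP => _; [apply: exprn_ege1; exact: root4_ge1|exact: lexx].
rewrite -mulr_sumr.
apply: (@le_trans _ _ (K / n * (7 * p ^+ (2 * j)))).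
  by apply: ler_wpM2l => //; exact: sum_root4_le.
have := root4_rate; move: (p ^+ (2 * j)) (rate ^+ 2) => y y' yy'.
rewrite [leLHS](_ : _ = 7 * K * (y / n)); last by ring.
by apply: ler_wpM2l => //; exact: mulr_ge0.
Qed.

End calibration.
End numerics.

(** * Separation from the smooth Besov ball *)

Section separation.
Context {R : realType} {S J0 z0 : nat} {psi : nat -> nat -> R -> R}.
Hypothesis basis : cdv_basis S J0 z0 psi.
Notation card := (card_Z J0 z0).
Variables (s t B alpha n : R).
Hypotheses (s0 : 0 < s) (t0 : 0 < t) (B0 : 0 < B) (n0 : 0 < n).
Hypotheses (a0 : 0 < alpha) (a2 : alpha <= 2).
Notation j := (level_j t n).
Hypothesis J0j : (J0 <= j)%N.
Notation tau := (tau J0 z0 t alpha n).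
Notation rate := (n `^ (- t / (2 * t + 2^-1))).

Let j1 : (1 <= j)%N.
Proof. exact: leq_trans (cdv_J0 basis) J0j. Qed.

(** Allows one margin [dl], common to all levels, in the construction of the approximant. *)
Lemma tau_min l : tau J0 <= tau l.
Proof.
have z1 := cdv_z0 basis.
have tp k : 0 <= tau k by apply: ltW; apply: tau_gt0.
rewrite -ler_sqr ?nnegrE// !sqr_tau// eqxx.
apply: ler_wpM2r; first by rewrite invr_ge0 ltW.
apply: ler_wpM2l.
  by apply: mulr_ge0; [exact: ler0n|apply: divr_ge0; [exact: ler0n|exact: ltW]].
by case: eqP => // _; rewrite exprn_ege1// root4_ge1.
Qed.

(** The factor by which the projection onto the ball of radius u multiplies a vector of norm x. *)
Definition shrink (x u : R) : R := if x <= u then 1 else u / x.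

Lemma shrink_le (x u : R) : 0 <= x -> 0 <= u -> 0 <= shrink x u * x <= u.
Proof.
rewrite /shrink => x0 u0; case: (leP x u) => [xu|ux]; first by rewrite mul1r x0.
by rewrite divfK ?gt_eqF ?(le_lt_trans u0)// u0 lexx.
Qed.

Lemma shrink_dist (x u e : R) : 0 <= u -> 0 <= e -> x <= u + e ->
  ((1 - shrink x u) * x) ^+ 2 <= e ^+ 2.
Proof.
rewrite /shrink => u0 e0 xue; case: (leP x u) => [_|ux].
  by rewrite subrr mul0r expr0n sqr_ge0.
have x0 : 0 < x by exact: le_lt_trans ux.
rewrite mulrBl mul1r divfK ?gt_eqF// ler_sqr ?nnegrE ?subr_ge0 ?(ltW ux)//.
by rewrite lerBlDl.
Qed.

Lemma dist2_lt (f : R -> R) : besov_ball J0 z0 psi t B f ->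
  (forall l, (J0 <= l <= j)%N ->
    Num.sqrt (level_energy J0 z0 psi f l) < B / 2 `^ (l%:R * s) + tau l) ->
  dist2 f (besov_ball J0 z0 psi s B) < rho z0 t B alpha n.
Proof.
move=> ft flt; have fL : L2 f by case: ft.
have z1 := cdv_z0 basis.
pose x l := Num.sqrt (level_energy J0 z0 psi f l).
have x0 l : 0 <= x l by exact: sqrtr_ge0.
have xE l : x l ^+ 2 = level_energy J0 z0 psi f l.
  by rewrite sqr_sqrtr// level_energy_ge0.
(* The Besov ball is open, so levels are shrunk to the radius given by B - [dl] instead of B. The
   first argument keeps this positive; the second makes the loss at level l at most $\tau_l$. *)
pose dl := Num.min (B / 2) (tau J0).
have dl0 : 0 < dl by rewrite lt_min divr_gt0//= tau_gt0.
have dlB : dl < B by rewrite gt_min ltr_pdivrMr// ltr_pMr// ltr1n.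
have dltau l : dl <= tau l by rewrite ge_min tau_min orbT.
pose B' := B - dl.
have B'0 : 0 < B' by rewrite subr_gt0.
pose u l := B' / 2 `^ (l%:R * s).
have u0 l : 0 <= u l by rewrite divr_ge0 ?powR_ge0// ltW.
pose c l := shrink (x l) (u l).
pose a l k := inner f (psi l k).
pose r := index_iota J0 j.+1.
have ur : uniq r by exact: iota_uniq.
have r0 m : all (leq J0) (index_iota J0 m).
  by apply/allP => l; rewrite mem_index_iota => /andP[].
pose g := wavelet_sum J0 z0 psi (fun l k => c l * a l k) r.
have gL : g \in Lfun (@lebesgue01 R) 2%:E by apply: (wavelet_sum_L2 basis); exact: r0.
have gball : besov_ball J0 z0 psi s B g.
  split; first exact: gL.
  apply: (@le_lt_trans _ _ B'%:E); last by rewrite lte_fin gtrBl.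
  apply: ub_ereal_sup => _ [l /= l0 <-]; rewrite lee_fin.
  have ig (k : 'I_(card l)) : inner g (psi l k) = if l \in r then c l * a l k else 0.
    by rewrite [LHS](inner_wavelet_psi basis)//; exact: r0.
  have [lr|lr] := boolP (l \in r); last first.
    rewrite big1 => [|k _]; first by rewrite sqrtr0 mulr0 ltW.
    by rewrite ig (negbTE lr) expr0n.
  rewrite (eq_bigr (fun k : 'I_(card l) => c l ^+ 2 * a l k ^+ 2)); last first.
    by move=> k _; rewrite ig lr exprMn.
  rewrite -mulr_sumr -/(level_energy J0 z0 psi f l) -xE -exprMn sqrtr_sqr.
  have /andP[cx0 cxu] := shrink_le (x0 l) (u0 l).
  rewrite ger0_norm// mulrC -ler_pdivlMr ?powR_gt0//.
have tailE l : (J0 <= l)%N -> level_energy J0 z0 psi f l <=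
    B ^+ 2 * (2 `^ (- (2 * t))) ^+ l.
  move=> l0; rewrite -xE.
  have -> : B ^+ 2 * (2 `^ (- (2 * t))) ^+ l = (B / 2 `^ (l%:R * t)) ^+ 2.
    have pE (q : R) k : (2 `^ q) ^+ k = 2 `^ (q * k%:R) by rewrite powRrM powR_mulrn// powR_ge0.
    by rewrite exprMn exprVn !pE -powRN; congr (_ * _ `^ _); ring.
  rewrite ler_sqr ?nnegrE ?divr_ge0 ?powR_ge0 ?(ltW B0)//.
  by rewrite ltW// (besov_ball_level l0).
pose w : R := 2 `^ (- (2 * t)).
have w01 : 0 <= w < 1.
  rewrite powR_ge0/= /w /powR pnatr_eq0/= -[ltRHS]expR0 ltr_expR.
  by rewrite mulNr oppr_lt0 !mulr_gt0// ln_gt0// ltr1n.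
have w1 : 0 < 1 - w by case/andP: w01 => _; rewrite subr_gt0.
pose D : R := 24 * Num.sqrt (z0%:R / alpha).
pose beta : R := B / Num.sqrt (1 - w).
have beta0 : 0 < beta by rewrite divr_gt0// sqrtr_gt0.
(* As $\alpha \le 2$ and $z_0 \ge 1$, the square root is at least $\sqrt{1/2}$. *)
have D1 : 1 <= D.
  rewrite /D; have za : 2^-1 <= z0%:R / alpha.
    have zr : 1 <= z0%:R :> R by rewrite ler1n.
    by rewrite ler_pdivlMr// (le_trans _ zr)// ler_pdivrMl// mulr1.
  have y0 := sqrtr_ge0 (z0%:R / alpha).
  have y2 : Num.sqrt (z0%:R / alpha) ^+ 2 = z0%:R / alpha.
    by rewrite sqr_sqrtr// (le_trans _ za)// invr_ge0.
  move: (Num.sqrt _) y0 y2 => y y0 y2.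
  rewrite leNgt; apply/negP => ylt; nra.
have rate0 : 0 < rate by exact: powR_gt0.
have rhoE : rho z0 t B alpha n = D * (2 `^ t * beta + 19) * rate.
  by rewrite /rho /C_tilde -/w /D /beta; ring.
(* Completeness is a convergence in norm: cutting at some N > j leaves a remainder below [D * rate],
   which $\tilde C$ can afford, and only finite sums are left. *)
pose h N := fun y => f y - wavelet_sum J0 z0 psi a (index_iota J0 N) y.
have [N jN hN] : exists2 N, (j < N)%N & norm2 (h N) < D * rate.
  have := cdv_complete basis fL.
  have Dr0 : 0 < D * rate by apply: mulr_gt0 => //; exact: lt_le_trans ltr01 D1.
  move=> /cvgrPdist_lt/(_ _ Dr0) [N0 _ HN].
  exists (maxn N0 j.+1); first by rewrite leq_maxr.
  have := HN (maxn N0 j.+1) (leq_maxl _ _).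
  by rewrite /= sub0r normrN; apply: le_lt_trans; exact: ler_norm.
(* Multipliers of f - g up to the cut: levels up to j were shrunk by [c], the later ones are missing
   from g. *)
pose e l := if (l < j.+1)%N then 1 - c l else 1.
pose v := wavelet_sum J0 z0 psi (fun l k => e l * a l k) (index_iota J0 N).
have vL : v \in Lfun (@lebesgue01 R) 2%:E by apply: (wavelet_sum_L2 basis); exact: r0.
have splitN (F : nat -> R) : \sum_(J0 <= l < N) F l =
    \sum_(J0 <= l < j.+1) F l + \sum_(j.+1 <= l < N) F l.
  by apply: big_cat_nat => //; exact: leqW.
have fgE : (f \- g) = (fun y => h N y + v y).
  apply/funext => y; rewrite /h /v /g /wavelet_sum /=.
  rewrite -addrA; congr (_ + _); rewrite /r.
  rewrite !splitN.
  have -> : \sum_(j.+1 <= l < N) level_sum J0 z0 psi (fun l k => e l * a l k) l y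
     = \sum_(j.+1 <= l < N) level_sum J0 z0 psi a l y.
    apply: eq_big_nat => l /andP[jl _]; apply: eq_bigr => k _.
    by rewrite /e ltnNge jl/= mul1r.
  rewrite opprD addrACA addNr addr0 -!sumrN -big_split/=; apply: eq_big_nat => l /andP[_ lj].
  rewrite /level_sum -!sumrN -big_split/=; apply: eq_bigr => k _.
  rewrite /e lj; move: (c l) (a l k) (psi l k y) => c1 a1 y1; ring.
have normv : norm2 v <= (6 * D + beta) * rate.
  have nv : norm2 v ^+ 2 = \sum_(J0 <= l < N) (e l * x l) ^+ 2.
    rewrite sqr_norm2// (inner_wavelet_self basis) ?iota_uniq//.
    apply: eq_big_nat => l _; rewrite exprMn xE /level_energy mulr_sumr.
    by apply: eq_bigr => k _; rewrite exprMn.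
  have rhs0 : 0 <= (6 * D + beta) * rate.
    by rewrite mulr_ge0 ?addr_ge0 ?mulr_ge0// ?ltW// (lt_le_trans ltr01).
  rewrite -ler_sqr ?nnegrE// ?fine_ge0 ?Lnorm_ge0// nv.
  rewrite splitN.
  (* At each level the excess over the radius [u l] is at most $2\tau_l$: one $\tau_l$ from the
     assumption on f, one from the margin [dl]. *)
  have h1 : \sum_(J0 <= l < j.+1) (e l * x l) ^+ 2 <= 4 * (7 * D ^+ 2 * rate ^+ 2).
    apply: (@le_trans _ _ (4 * \sum_(J0 <= l < j.+1) tau l ^+ 2)); last first.
      by rewrite ler_wpM2l//; exact: sum_sqr_tau_le.
    rewrite mulr_sumr big_nat_cond [leRHS]big_nat_cond.
    apply: ler_sum => l /andP[/andP[l0 lj] _]; rewrite /e lj.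
    rewrite (_ : 4 * tau l ^+ 2 = (2 * tau l) ^+ 2); last by ring.
    have tl : 0 < tau l by apply: tau_gt0.
    apply: shrink_dist => //; first by rewrite mulr_ge0// ltW.
    have := flt l; rewrite l0 -ltnS lj => /(_ isT)/ltW/le_trans; apply.
    have p1 : 1 <= 2 `^ (l%:R * s) :> R.
      rewrite /powR pnatr_eq0/= -[leLHS]expR0 ler_expR !mulr_ge0 ?(ltW s0)//.
      by rewrite ln_ge0// ler1n.
    have : dl / 2 `^ (l%:R * s) <= tau l.
      rewrite (le_trans _ (dltau l))// ler_pdivrMr ?powR_gt0//.
      by rewrite ler_peMr// ltW.
    rewrite /u /B' mulrBl; lra.
  have h2 : \sum_(j.+1 <= l < N) (e l * x l) ^+ 2 <= beta ^+ 2 * rate ^+ 2.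
    apply: (@le_trans _ _ (B ^+ 2 * \sum_(j.+1 <= l < N) w ^+ l)).
      rewrite mulr_sumr big_nat_cond [leRHS]big_nat_cond.
      apply: ler_sum => l /andP[/andP[jl lN] _]; rewrite /e ltnNge jl/= mul1r xE tailE//.
      by rewrite (leq_trans J0j)// ltnW.
    have -> : beta ^+ 2 = B ^+ 2 / (1 - w) by rewrite exprMn exprVn sqr_sqrtr// ltW.
    rewrite -[leRHS]mulrA; apply: ler_wpM2l; first exact: sqr_ge0.
    apply: (le_trans (geometric_tail_le _ _ w01)).
    by rewrite mulrC ler_wpM2l ?invr_ge0 ?(ltW w1)//; exact: tail_rate.
  apply: (le_trans (lerD h1 h2)).
  (* The constant 6 is an integer above $\sqrt{28}$. *)
  have alg (y b q : R) : 0 <= y -> 0 <= b ->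
      4 * (7 * y ^+ 2 * q ^+ 2) + b ^+ 2 * q ^+ 2 <= ((6 * y + b) * q) ^+ 2.
    move=> y0 b0; rewrite -subr_ge0.
    rewrite [X in 0 <= X](_ : _ = (8 * y ^+ 2 + 12 * (y * b)) * q ^+ 2); last by ring.
    apply: mulr_ge0; last exact: sqr_ge0.
    by apply: addr_ge0; apply: mulr_ge0 => //; [exact: sqr_ge0|exact: mulr_ge0].
  by apply: alg; [exact: le_trans ler01 D1|exact: ltW].
have hL : h N \in Lfun (@lebesgue01 R) 2%:E.
  by apply: Lfun2_sub => //; apply: (wavelet_sum_L2 basis); exact: r0.
apply: (@le_lt_trans _ _ (norm2 (f \- g))).
  apply: ge_inf; last by exists g.
  by exists 0 => _ [q _ <-]; rewrite fine_ge0// Lnorm_ge0.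
rewrite fgE; apply: (le_lt_trans (fine_Lnorm_triangle hL vL)).
apply: (lt_le_trans (ltr_leD hN normv)).
rewrite rhoE -mulrDl ler_pM2r//.
have t1 : 1 <= 2 `^ t :> R.
  rewrite /powR pnatr_eq0/= -[leLHS]expR0 ler_expR mulr_ge0 ?(ltW t0)//.
  by rewrite ln_ge0// ler1n.
have bD : beta <= D * (2 `^ t * beta).
  by rewrite mulrA; apply: ler_peMl; [exact: ltW|exact: mulr_ege1].
(* The remainder, the shrunk levels and the tail use 7 of the 19 units of D. *)
have alg (y b z : R) : 1 <= y -> b <= y * z -> y + (6 * y + b) <= y * (z + 19).
  by move=> y1 byz; rewrite mulrDr; lra.
exact: alg.
Qed.

End separation.

(** * Errors of the test *)

Lemma indic_setC {R : pzRingType} {T : Type} (A : set T) (w : T) :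
  \1_(~` A) w = 1 - \1_A w :> R.
Proof. by rewrite indicC indicE; case: (w \in A); rewrite ?subrr ?subr0. Qed.

Section acceptance_region.
Context {R : realType} {d : measure_display} {T : measurableType d}.
Variable P : probability T R.

Lemma prod_indic_event (r : seq nat) (E : nat -> set T) :
  (forall l, l \in r -> measurable (E l)) ->
  exists A : set T, [/\ measurable A,
    forall w, \prod_(l <- r) \1_(E l) w = \1_A w :> R,
    (P (~` A) <= \sum_(l <- r) P (~` E l))%E &
    forall l, l \in r -> A `<=` E l].
Proof.
elim: r => [_|l r IH mE].
  exists setT; split => //.
  - by move=> w; rewrite big_nil indicT.
  - by rewrite big_nil setCT measure0.
have mEl : measurable (E l) by apply: mE; rewrite mem_head.
have [|A [mA prodA PA AE]] := IH.
  by move=> k kr; apply: mE; rewrite inE kr orbT.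
exists (E l `&` A); split.
- exact: measurableI.
- by move=> w; rewrite big_cons prodA indicI.
- rewrite big_cons setCI; apply: le_trans (leeD2l _ PA).
  by apply: measureU2; exact: measurableC.
- move=> k; rewrite inE => /predU1P[->|kr] w [El Aw]//.
  exact: AE Aw.
Qed.

Lemma fine_expectation_indic_le (X : T -> R) (A : set T) (c : R) : measurable A ->
  (forall w, X w = \1_A w) -> (P A <= c%:E)%E -> fine 'E_P[X] <= c.
Proof.
move=> mA XA PA; have -> : X = \1_A by apply/funext.
rewrite expectation_indic// -lee_fin fineK//; exact: fin_num_measure.
Qed.

End acceptance_region.

(** The sign condition on c covers the empty set, whose [sup] is 0. *)
Lemma sup_le_nonneg {R : realType} (A : set R) (c : R) :
  0 <= c -> (forall x, A x -> x <= c) -> sup A <= c.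
Proof.
move=> c0 Ac; have [->|A0] := eqVneq A set0; first by rewrite sup0.
by apply: ge_sup; [exact/set0P|exact: Ac].
Qed.

Section risk.
Context {R : realType} {d : measure_display} {Omega : measurableType d}.
Variables (P : probability Omega R) (Bm : R -> {RV P >-> R}).
Variables (W : (R -> R) -> {RV P >-> R}).
Hypothesis WI : wiener_integral Bm W.
Context {S J0 z0 : nat} {psi : nat -> nat -> R -> R}.
Hypothesis basis : cdv_basis S J0 z0 psi.
Variables (s t B alpha n : R).
Hypotheses (s0 : 0 < s) (t0 : 0 < t) (B0 : 0 < B) (n0 : 0 < n).
Hypotheses (a0 : 0 < alpha).
Notation j := (level_j t n).
Hypothesis J0j : (J0 <= j)%N.
Notation test := (test_Psi J0 z0 psi s t B alpha n).
Notation thr := (threshold J0 z0 s t B alpha n).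
Notation T f l w := (T_stat J0 z0 psi n (observation W n f w) l).
Notation tau := (tau J0 z0 t alpha n).
Notation risk := (level_risk t n z0 J0 alpha).

Definition accept_level (f : R -> R) (l : nat) : set Omega :=
  [set w | T f l w < thr l ^+ 2].

Lemma measurable_accept_level f l : (J0 <= l)%N -> measurable (accept_level f l).
Proof.
move=> l0; rewrite (_ : accept_level f l = ~` [set w | thr l ^+ 2 <= T f l w]).
  apply: measurableC; rewrite -[X in measurable X]setTI.
  apply: measurable_fun_le => //; exact: (measurable_T_stat basis W n0).
by apply/seteqP; split => w; rewrite /accept_level/= ltNge => /negP.
Qed.

Lemma test_accept f : exists A : set Omega, [/\ measurable A,
  forall w, test (observation W n f w) = \1_(~` A) w,
  (P (~` A) <= \sum_(J0 <= l < j.+1) P (~` accept_level f l))%E &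
  forall l, (J0 <= l <= j)%N -> A `<=` accept_level f l].
Proof.
have [|A [mA prodA PA AE]] := @prod_indic_event R _ _ P (index_iota J0 j.+1) (accept_level f).
  by move=> l; rewrite mem_index_iota => /andP[l0 _]; exact: measurable_accept_level.
exists A; split => //.
- move=> w; rewrite /test_Psi indic_setC -prodA; congr (1 - _).
  apply: eq_bigr => l _; rewrite indicE.
  rewrite (_ : (w \in accept_level f l) = (T f l w < thr l ^+ 2))//.
  by apply/idP/idP; rewrite inE.
- by move=> l ljJ; apply: AE; rewrite mem_index_iota ltnS.
Qed.

(** Settles the case $\alpha > 2$, where bounding each error by 1 is enough. *)
Lemma expect_test_01 f : 0 <= expect W n f test <= 1 /\
  0 <= expect W n f (fun Y => 1 - test Y) <= 1.
Proof.
have [A [mA testA _ _]] := test_accept f.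
have mCA := measurableC mA.
have X0 (X : Omega -> R) : (forall w, 0 <= X w) -> 0 <= fine 'E_P[X].
  by move=> ?; rewrite fine_ge0// expectation_ge0.
have i01 D (w : Omega) : 0 <= \1_D w :> R by rewrite indicE.
split; apply/andP; split.
- by apply: X0 => w; rewrite testA.
- apply: (fine_expectation_indic_le (A := ~` A)) => //; exact: probability_le1.
- by apply: X0 => w; rewrite testA indic_setC opprB addrCA subrr addr0.
- apply: (fine_expectation_indic_le (A := A)) => //; last exact: probability_le1.
  by move=> w; rewrite testA indic_setC opprB addrCA subrr addr0.
Qed.

(** A rejection forces the statistic to exceed the energy $x^2$ by at least [thr l ^+ 2 - x ^+ 2],
    which is positive because $x \le B 2^{-ls}$. *)
Lemma accept_level_null f l : (J0 <= l)%N -> besov_ball J0 z0 psi s B f ->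
  (P (~` accept_level f l) <= (risk l)%:E)%E.
Proof.
move=> l0 fB; set x := Num.sqrt (level_energy J0 z0 psi f l).
have x0 : 0 <= x by exact: sqrtr_ge0.
have xE : x ^+ 2 = level_energy J0 z0 psi f l.
  by rewrite sqr_sqrtr// level_energy_ge0.
have xb : x <= B / 2 `^ (l%:R * s) by exact/ltW/(besov_ball_level l0 fB).
have tp : 0 < tau l.
  by apply: tau_gt0 => //; exact: cdv_z0 basis.
have c0 : 0 < thr l ^+ 2 - x ^+ 2.
  rewrite subr_gt0 /threshold ltr_sqr ?nnegrE//; last by lra.
  by lra.
have tail := T_stat_tail basis WI n0 f l0 c0.
apply: (@le_trans _ _ (P [set w | thr l ^+ 2 - x ^+ 2 <=
    `|T f l w - level_energy J0 z0 psi f l|])).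
  apply: le_measure; rewrite ?inE.
  - by apply: measurableC; exact: measurable_accept_level.
  - rewrite -[X in measurable X]setTI; apply: measurable_fun_le => //.
    apply: measurableT_comp => //; apply: measurable_funB => //.
    exact: (measurable_T_stat basis W n0).
  - move=> w /= /negP; rewrite -leNgt -xE => thrT.
    by rewrite (le_trans _ (ler_norm _))// lerD2r.
apply: (le_trans tail); rewrite lee_fin -xE.
apply: quotient_le_null; [| |by rewrite x0|exact: tp].
  by apply: divr_ge0; [exact: ler0n|exact: ltW].
by apply: divr_ge0; [apply: mulr_ge0; exact: ler0n|exact: exprn_ge0 (ltW n0)].
Qed.

(** An acceptance forces the statistic below the energy by more than [x ^+ 2 - thr l ^+ 2], positive
    because x exceeds the square root of the threshold by at least $\tau_l/2$. *)
Lemma accept_level_alternative f l : (J0 <= l)%N ->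
  B / 2 `^ (l%:R * s) + tau l <= Num.sqrt (level_energy J0 z0 psi f l) ->
  (P (accept_level f l) <= (4 * risk l)%:E)%E.
Proof.
move=> l0; set x := Num.sqrt _ => xb.
have xE : x ^+ 2 = level_energy J0 z0 psi f l.
  by rewrite sqr_sqrtr// level_energy_ge0.
have b0 : 0 <= B / 2 `^ (l%:R * s) by rewrite divr_ge0 ?powR_ge0// ltW.
have tp : 0 < tau l.
  by apply: tau_gt0 => //; exact: cdv_z0 basis.
have c0 : 0 < x ^+ 2 - thr l ^+ 2.
  rewrite subr_gt0 /threshold ltr_sqr ?nnegrE; lra.
have tail := T_stat_tail basis WI n0 f l0 c0.
apply: (@le_trans _ _ (P [set w | x ^+ 2 - thr l ^+ 2 <=
    `|T f l w - level_energy J0 z0 psi f l|])).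
  apply: le_measure; rewrite ?inE.
  - exact: measurable_accept_level.
  - rewrite -[X in measurable X]setTI; apply: measurable_fun_le => //.
    apply: measurableT_comp => //; apply: measurable_funB => //.
    exact: (measurable_T_stat basis W n0).
  - move=> w; rewrite /accept_level /= -xE distrC => thrT.
    by rewrite (le_trans _ (ler_norm _))// lerD2l lerN2 ltW.
apply: (le_trans tail); rewrite lee_fin -xE.
apply: quotient_le_alternative; [| |exact: b0|exact: tp|exact: xb].
  by apply: divr_ge0; [exact: ler0n|exact: ltW].
by apply: divr_ge0; [apply: mulr_ge0; exact: ler0n|exact: exprn_ge0 (ltW n0)].
Qed.

Hypothesis a2 : alpha <= 2.

Lemma expect_null_le f : besov_ball J0 z0 psi s B f -> expect W n f test <= alpha / 3.
Proof.
move=> fB; have [A [mA testA PA _]] := test_accept f.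
apply: (fine_expectation_indic_le (measurableC mA)) => //.
apply: (le_trans PA).
apply: (@le_trans _ _ (\sum_(J0 <= l < j.+1) (risk l)%:E)%E).
  rewrite big_nat_cond [leRHS]big_nat_cond; apply: lee_sum => l /andP[/andP[l0 _] _].
  exact: accept_level_null.
rewrite sumEFin lee_fin; apply: sum_level_risk_le => //; exact: (cdv_z0 basis).
Qed.

(** Accepting requires accepting at every level, so a single well separated level suffices and no
    sum appears: the bound is $4 \cdot \alpha/24$. *)
Lemma expect_alternative_le f :
  besov_ball_sep J0 z0 psi s t B (rho z0 t B alpha n) f ->
  expect W n f (fun Y => 1 - test Y) <= alpha / 6.
Proof.
move=> [ft fsep].
have [A [mA testA _ AE]] := test_accept f.
have [l ljJ lsep] : exists2 l, (J0 <= l <= j)%N & B / 2 `^ (l%:R * s) + tau l <=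
    Num.sqrt (level_energy J0 z0 psi f l).
  (* If no level were separated, [dist2_lt] would put f closer than [rho] to the smooth ball. *)
  apply: contrapT => nosep; move: fsep; apply/negP; rewrite -ltNge.
  apply: (dist2_lt basis) => // l ljJ; rewrite ltNge; apply/negP => lsep.
  by apply: nosep; exists l.
have /andP[l0 lj] := ljJ.
apply: (fine_expectation_indic_le mA).
  by move=> w; rewrite testA indic_setC opprB addrCA subrr addr0.
apply: (@le_trans _ _ (P (accept_level f l))).
  apply: le_measure; rewrite ?inE//; first exact: measurable_accept_level.
  exact: AE.
apply: (le_trans (accept_level_alternative l0 lsep)); rewrite lee_fin.
have rl : risk l <= alpha / 24.
  apply: (@le_trans _ _ (alpha / 24 * (if l == J0 then 1 else root4^-1 ^+ (j - l)))).
    by apply: level_risk_le => //; exact: (cdv_z0 basis).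
  rewrite ler_piMr ?divr_ge0 ?(ltW a0)//; case: ifP => // _.
  by rewrite exprn_ile1 ?invr_ge0 ?(ltW (root4_gt0))// invf_le1 ?root4_gt0// root4_ge1.
lra.
Qed.

End risk.

(* The suprema are those of sets of reals in [0,1]; sup set0 = 0, which is the
   right convention when the alternative is empty. *)
Theorem theorem3p1 (R : realType) (d : measure_display)
    (Omega : measurableType d) (P : probability Omega R)
    (Bm : R -> {RV P >-> R}) (W : (R -> R) -> {RV P >-> R})
    (S J0 z0 : nat) (psi : nat -> nat -> R -> R) (s t B alpha n : R) :
  brownian_motion Bm -> wiener_integral Bm W ->
  cdv_basis S J0 z0 psi ->
  s <= S%:R -> t < s -> 0 < t -> 0 < B -> 0 < alpha ->
  0 < n -> (J0 <= level_j t n)%N ->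
  sup [set expect W n f (test_Psi J0 z0 psi s t B alpha n)
      | f in besov_ball J0 z0 psi s B] +
  sup [set expect W n f (fun Y => 1 - test_Psi J0 z0 psi s t B alpha n Y)
      | f in besov_ball_sep J0 z0 psi s t B (rho z0 t B alpha n)]
  <= alpha.
Proof.
move=> _ WI basis _ ts t0 B0 a0 n0 J0j.
have s0 : 0 < s by exact: lt_trans ts.
have [a2|a2] := leP alpha 2.
  apply: (@le_trans _ _ (alpha / 3 + alpha / 6)); last by lra.
  apply: lerD; apply: sup_le_nonneg; rewrite ?divr_ge0 ?(ltW a0)// => _ [f fB <-].
    exact: (expect_null_le WI basis).
  exact: (expect_alternative_le WI basis).
apply: (@le_trans _ _ (1 + 1)); last by lra.
by apply: lerD; apply: sup_le_nonneg => // _ [f fB <-];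
  have [/andP[_ H1] /andP[_ H2]] := expect_test_01 W basis s t B alpha n0 f.
Qed.
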